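(* (1) Let $n\geq 1$, let $p_1,\dots,p_n$ be distinct odd primes, and let $G=F(2,p_1,\dots,p_n)$ be the Brown-Stein-Thompson group. Then $G$ does not embed into Thompson's group $F$. (2) The Bieri-Strebel group $G(I;A,P)$ does not embed into $F$ provided $P<\mathbf{R}_+^*$ has abelian rank greater than one.
   Context: $F(2,p_1,\dots,p_n)$ is the group of orientation preserving piecewise linear homeomorphisms of $[0,1]$ with finitely many breakpoints, whose slopes, wherever they exist, lie in the multiplicative group $\langle 2,p_1,\dots,p_n\rangle<\mathbf{R}_+^*$, and whose breakpoints lie in $\mathbf{Z}[\frac{1}{2p_1\cdots p_n}]\cap(0,1)$. Here $I$ is $\mathbf{R}$ or a compact interval of positive length, $\mathbf{R}_+^*$ is the multiplicative group of positive reals, $P$ is a subgroup of $\mathbf{R}_+^*$, and $A$ is a nonzero additive $\mathbf{Z}[P]$-submodule of $\mathbf{R}$. The Bieri-Strebel group $G(I;A,P)$ is the group of all orientation preserving piecewise linear homeomorphisms of $\mathbf{R}$ with finitely many breakpoints, with support contained in $I$, slopes in $P$, breakpoints in $A$, and mapping $A$ onto $A$. The support of $g$ is the set of points it moves. The abelian rank of an abelian group $P$ is its torsion-free rank $\dim_{\mathbf{Q}}(P\otimes\mathbf{Q})$. Thompson's group $F$ is the group of orientation preserving piecewise linear homeomorphisms of $[0,1]$ with finitely many breakpoints, all dyadic rationals, and whose derivatives, wherever they exist, are powers of $2$. ''Embeds'' means: there is an injective group homomorphism. *)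

(* Defs.v *)
From HB Require Import structures.
From mathcomp Require Import all_boot all_order all_algebra.
From mathcomp Require Import all_classical all_reals all_analysis.

Set Implicit Arguments.
Unset Strict Implicit.
Unset Printing Implicit Defensive.

Import Order.TTheory GRing.Theory Num.Theory.
Import numFieldNormedType.Exports.

Local Open Scope classical_set_scope.
Local Open Scope ring_scope.

(** A homeomorphism of a subset J of R is represented by a function R -> R that
    is the identity outside J, so that two homeomorphisms of J are equal iff the
    functions representing them are, and composition is [\o]. *)
Definition homeomorphism (R : realType) (J : set R) (f : R -> R) : Prop :=
  (forall x, ~ J x -> f x = x) /\
  exists g : R -> R,
    [/\ set_fun J J f /\ set_fun J J g,
        (forall x, J x -> g (f x) = x) /\ (forall x, J x -> f (g x) = x),
        {within J, continuous f} & {within J, continuous g}].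

Definition orientation_preserving (R : realType) (J : set R) (f : R -> R) :=
  forall x y, J x -> J y -> x < y -> f x < f y.

(** [has_slope f x a]: f is affine with slope a on a neighbourhood of x. *)
Definition has_slope (R : realType) (f : R -> R) (x a : R) : Prop :=
  exists b : R, \forall y \near x, f y = a * y + b.

(** Only interior points of J count: the endpoints of a compact interval are
    neither breakpoints nor points with a (two-sided) slope. *)
Definition breakpoints (R : realType) (J : set R) (f : R -> R) : set R :=
  [set x | interior J x /\ ~ exists a, has_slope f x a].

Definition slopes (R : realType) (J : set R) (f : R -> R) : set R :=
  [set a | exists2 x, interior J x & has_slope f x a].

Definition pl_homeo (R : realType) (J : set R) (f : R -> R) : Prop :=
  [/\ homeomorphism J f, orientation_preserving J f &
      finite_set (breakpoints J f)].

Definition support (R : realType) (f : R -> R) : set R := [set x | f x != x].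

Definition positive_subgroup (R : realType) (P : set R) : Prop :=
  [/\ forall x, P x -> 0 < x, P 1,
      forall x y, P x -> P y -> P (x * y) &
      forall x, P x -> P x^-1].

(** A nonzero Z[P]-submodule of R. *)
Definition nonzero_submodule (R : realType) (P A : set R) : Prop :=
  [/\ A 0, forall x y, A x -> A y -> A (x - y),
      forall a x, P a -> A x -> A (a * x) &
      exists2 x, A x & x != 0].

Definition bieri_strebel (R : realType) (I A P : set R) : set (R -> R) :=
  [set f | [/\ pl_homeo setT f, support f `<=` I, slopes setT f `<=` P,
               breakpoints setT f `<=` A & f @` A = A]].

(** The ring Z[1/m]. *)
Definition Zinv (R : realType) (m : nat) : set R :=
  [set x | exists (a : int) (k : nat), x = a%:~R / m%:R ^+ k].
Arguments Zinv : clear implicits.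

Definition thompsonF (R : realType) : set (R -> R) :=
  [set f | [/\ pl_homeo `[0, 1] f,
               breakpoints `[0, 1] f `<=` Zinv R 2 &
               slopes `[0, 1] f `<=` [set a | exists k : int, a = 2 ^ k]]].
Arguments thompsonF : clear implicits.

(** [smallest positive_subgroup S] is the subgroup of R_+^* generated by S. *)
Definition brown_stein_thompson (R : realType) (n : nat) (p : 'I_n -> nat) :
    set (R -> R) :=
  [set f | [/\ pl_homeo `[0, 1] f,
               breakpoints `[0, 1] f `<=` Zinv R (2 * \prod_(i < n) p i)%N &
               slopes `[0, 1] f `<=`
                 smallest (@positive_subgroup R)
                   (2%:R |` [set (p i)%:R | i in [set: 'I_n]])]].
Arguments brown_stein_thompson R {n} p.

(** Injective homomorphisms between groups of transformations of R, whose
    group law is composition. *)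
Definition embeds (R : realType) (G H : set (R -> R)) : Prop :=
  exists phi : (R -> R) -> (R -> R),
    [/\ set_fun G H phi, set_inj G phi &
        forall f g, G f -> G g -> phi (f \o g) = phi f \o phi g].

(** Z-bilinear maps P x Q -> V, the law of P being written multiplicatively. *)
Definition bilinear_rat (R : realType) (P : set R) (V : zmodType)
    (f : R -> rat -> V) : Prop :=
  (forall x y q, P x -> P y -> f (x * y) q = f x q + f y q) /\
  (forall x q r, P x -> f x (q + r) = f x q + f x r).

(** The Q-vector space T, with [t x q] standing for the tensor of x and q, is
    the tensor product over Z of P and Q. *)
Definition is_tensor_rat (R : realType) (P : set R) (T : lmodType rat)
    (t : R -> rat -> T) : Prop :=
  [/\ bilinear_rat P t,
      forall c x q, P x -> c *: t x q = t x (c * q),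
      forall (V : zmodType) (f : R -> rat -> V), bilinear_rat P f ->
        exists h : {additive T -> V}, forall x q, P x -> h (t x q) = f x q &
      forall (V : zmodType) (h1 h2 : {additive T -> V}),
        (forall x q, P x -> h1 (t x q) = h2 (t x q)) -> h1 =1 h2].

(** T may be infinite-dimensional, so "dimension > n" is the existence of n+1
    linearly independent vectors. *)
Definition dim_gt (T : lmodType rat) (n : nat) : Prop :=
  exists v : 'I_n.+1 -> T, forall c : 'I_n.+1 -> rat,
    \sum_i c i *: v i = 0 -> forall i, c i = 0.

Definition abelian_rank_gt (R : realType) (P : set R) (n : nat) : Prop :=
  exists (T : lmodType rat) (t : R -> rat -> T),
    is_tensor_rat P t /\ dim_gt T n.

(* Main.v *)
Require Import Defs.
From HB Require Import structures.
From mathcomp Require Import all_boot all_order all_algebra.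
From mathcomp Require Import all_classical all_reals all_analysis.
From mathcomp Require Import zify ring lra.

Set Implicit Arguments.
Unset Strict Implicit.
Unset Printing Implicit Defensive.

Import Order.TTheory GRing.Theory Num.Theory.
Import numFieldNormedType.Exports.

Local Open Scope classical_set_scope.
Local Open Scope ring_scope.

(** Both families contain, for a suitable segment [p, q] and numbers a, b > 1 in P
    generating a free abelian group of rank 2, the group H of all piecewise linear
    maps supported in [p, q] that preserve A and have slopes in P and breakpoints
    in A. So it is enough that no injective homomorphism Phi from H to F exists.

    What distinguishes F is that its one-sided germs at a fixed point are infinite
    cyclic, slopes being powers of 2, whereas H has germs with independent slopes.
    Suppose Phi exists, and restrict the action Phi(H) to the convex hull [u, v] of
    an orbit. The points u and v are globally fixed. If b0 is a commutator that
    belongs to every nontrivial normal subgroup of H ([commutator_in_normal]) and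
    the orbit is that of a point moved by Phi(b0), the restricted action is still
    faithful. Take f and g in H that move all of (p, q) to the left. The slopes of
    Phi(f) and Phi(g) at u are powers of 2, so some nontrivial word w = f^m g^n or w
    = f^m g^-n has Phi(w) equal to the identity near u. Commutators act trivially
    near v. As the orbit accumulates at u and at v, any finite set D of commutators
    can be conjugated by one element of H so that their images live where Phi(w) is
    the identity; by faithfulness w commutes, in H, with the conjugates
    ([commutators_displaced]).

    This is absurd for the original action of H on [p, q]. Choose f with slopes
    1/a, b and g with slopes 1/b, a. By independence f^m and g^n agree on no
    interval, so w has only finitely many fixed points ([word_fix_finite]). On the
    other hand a map commuting with b0 fixes the last point e of its support; taking
    for D the conjugates of b0 by 1, f, ..., f^N yields N + 1 distinct fixed points
    of w, for every N ([pl_supp_no_dyadic_action]).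

    The numbers a and b come from the rank of P: if any two elements of P were
    dependent, the tensor product of P with the rationals would be spanned by a
    single vector ([tensor_rank_le1]). For Brown-Stein-Thompson groups they are 2
    and an odd prime. *)

(** * Increasing bijections of the line *)

Record oaut (R : realType) : Type := Oaut {
  oaut_fun :> R -> R;
  oaut_inv : R -> R;
  oaut_can : cancel oaut_fun oaut_inv;
  oaut_cani : cancel oaut_inv oaut_fun;
  oaut_lt : {homo oaut_fun : x y / x < y} }.

HB.instance Definition _ (R : realType) := gen_eqMixin (oaut R).
HB.instance Definition _ (R : realType) := gen_choiceMixin (oaut R).

Section OautGroup.
Variable R : realType.
Implicit Types f g h : oaut R.

Lemma oaut_ext f g : f =1 g -> f = g.
Proof.
case: f g => [f f' fK f'K fm] [g g' gK g'K gm] /= fg.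
have efg : f = g by exact/funext.
subst g; have e' : f' = g'.
  by apply/funext => x; rewrite -{1}(g'K x) fK.
by subst g'; congr Oaut; apply: Prop_irrelevance.
Qed.

Lemma oaut_leE f : {mono f : x y / x <= y}.
Proof. by apply: le_mono; exact: oaut_lt. Qed.

Lemma oaut_ltE f : {mono f : x y / x < y}.
Proof. exact: leW_mono (oaut_leE f). Qed.

Definition oaut1 : oaut R :=
  @Oaut R idfun idfun (fun=> erefl) (fun=> erefl) (fun _ _ => id).

Definition oautM f g : oaut R :=
  Oaut (can_comp (@oaut_can _ f) (@oaut_can _ g))
       (can_comp (@oaut_cani _ g) (@oaut_cani _ f))
       (fun x y xy => oaut_lt f (oaut_lt g xy)).

Lemma oaut_inv_lt f : {homo oaut_inv f : x y / x < y}.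
Proof. by move=> x y xy; rewrite -(oaut_ltE f) !oaut_cani. Qed.

Definition oautV f : oaut R :=
  Oaut (@oaut_cani _ f) (@oaut_can _ f) (oaut_inv_lt f).

Lemma oautA : associative oautM.
Proof. by move=> f g h; apply: oaut_ext. Qed.
Lemma oaut1M : left_id oaut1 oautM.
Proof. by move=> f; apply: oaut_ext. Qed.
Lemma oautM1 : right_id oaut1 oautM.
Proof. by move=> f; apply: oaut_ext. Qed.
Lemma oautVM : left_inverse oaut1 oautV oautM.
Proof. by move=> f; apply: oaut_ext => x /=; rewrite oaut_can. Qed.
Lemma oautMV : right_inverse oaut1 oautV oautM.
Proof. by move=> f; apply: oaut_ext => x /=; rewrite oaut_cani. Qed.

HB.instance Definition _ :=
  isGroup.Build (oaut R) oautA oaut1M oautM1 oautVM oautMV.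

Lemma oautME f g x : (f * g)%g x = f (g x). Proof. by []. Qed.
Lemma oautK f : cancel f (f^-1)%g. Proof. exact: oaut_can. Qed.
Lemma oautVK f : cancel (f^-1)%g f. Proof. exact: oaut_cani. Qed.
Lemma oautI f : injective f. Proof. exact: can_inj (oautK f). Qed.

Lemma oaut_ltV f x y : (f x < y) = (x < (f^-1)%g y).
Proof. by rewrite -{1}(oautVK f y) oaut_ltE. Qed.
Lemma oaut_gtV f x y : (x < f y) = ((f^-1)%g x < y).
Proof. by rewrite -{1}(oautVK f x) oaut_ltE. Qed.
Lemma oaut_leV f x y : (f x <= y) = (x <= (f^-1)%g y).
Proof. by rewrite -{1}(oautVK f y) oaut_leE. Qed.
Lemma oaut_geV f x y : (x <= f y) = ((f^-1)%g x <= y).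
Proof. by rewrite -{1}(oautVK f x) oaut_leE. Qed.
Lemma oaut_fixV f x : f x = x -> (f^-1)%g x = x.
Proof. by move=> fx; rewrite -{1}fx oautK. Qed.
Lemma oaut_fixX f x n : f x = x -> (f ^+ n)%g x = x.
Proof. by move=> fx; elim: n => [//|n IH]; rewrite expgS oautME IH. Qed.

(** Invariant bounded sets have fixed suprema and infima: this is how global
    fixed points are produced below. *)
Lemma oaut_fix_sup f (S : set R) : has_sup S ->
  (forall x, S x -> S (f x)) -> (forall x, S x -> S ((f^-1)%g x)) ->
  f (sup S) = sup S.
Proof.
move=> [S0 Sub] Sf Sf'; apply/eqP; rewrite eq_le; apply/andP; split.
- rewrite oaut_leV; apply: ge_sup => // x /Sf Sx.
  by rewrite -oaut_leV; apply: ub_le_sup.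
- apply: ge_sup => // x /Sf' Sx; rewrite oaut_geV.
  exact: ub_le_sup.
Qed.

Lemma oaut_fix_inf f (S : set R) : has_inf S ->
  (forall x, S x -> S (f x)) -> (forall x, S x -> S ((f^-1)%g x)) ->
  f (inf S) = inf S.
Proof.
move=> [S0 Slb] Sf Sf'; apply/eqP; rewrite eq_le; apply/andP; split.
- apply: lb_le_inf => // x /Sf' Sx; rewrite oaut_leV.
  exact: ge_inf.
- rewrite oaut_geV; apply: lb_le_inf => // x /Sf Sx.
  by rewrite -oaut_geV; apply: ge_inf.
Qed.

(** The supremum of the orbit of [s] would be a fixed point in (p, q). *)
Lemma oaut_climb f (p q s a : R) : f q = q ->
  (forall x, p < x < q -> x < f x) -> p < s -> a < q ->
  exists n, a < (f ^+ n)%g s.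
Proof.
move=> fq fup ps aq; apply: contrapT => /forallNP nex.
have le_a n : (f ^+ n)%g s <= a by rewrite leNgt; apply/negP/nex.
pose S := [set (f ^+ n)%g s | n in [set: nat]].
have S0 : S !=set0 by exists s; exists 0%N.
have Sub : ubound S a by move=> _ [n _ <-].
have sS : s <= sup S by apply: ub_le_sup; [exists a | exists 0%N].
have Sa : sup S <= a by exact: ge_sup.
have : (f^-1)%g (sup S) < sup S.
  by rewrite -oaut_gtV fup// (lt_le_trans ps sS) (le_lt_trans Sa aq).
case/(sup_gt S0) => _ [n _ <-]; rewrite -oaut_gtV -oautME -expgS => lt_S.
have : (f ^+ n.+1)%g s <= sup S by apply: ub_le_sup; [exists a | exists n.+1].
by rewrite leNgt lt_S.
Qed.

End OautGroup.

(** * One-sided affine germs *)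

Section Germs.
Variable R : realType.
Implicit Types (f g : oaut R) (F G : R -> R) (d : bool) (x s t : R).

(** The side is a sign, [d = false] for the right and [d = true] for the left,
    so that every germ computation is done once for both sides. *)
Definition germ d F (x s : R) : Prop :=
  exists2 e : R, 0 < e &
    forall h : R, 0 <= h <= e -> F (x + (-1) ^+ d * h) = F x + (-1) ^+ d * (s * h).

Lemma germ_uniq d F x s t : germ d F x s -> germ d F x t -> s = t.
Proof.
move=> [e e0 H] [e' e0' H'].
have m0 : 0 < Num.min e e' by rewrite lt_min e0.
have m1 : Num.min e e' <= e by rewrite ge_min lexx.
have m2 : Num.min e e' <= e' by rewrite ge_min lexx orbT.
have := H (Num.min e e'); rewrite H' (ltW m0) ?m1 ?m2// => /(_ isT).
move/addrI/(mulfI (negbT (signr_eq0 R d))).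
by move/(mulIf (lt0r_neq0 m0)).
Qed.

Lemma germ_id d x : germ d idfun x 1.
Proof. by exists 1 => // h _; rewrite mul1r. Qed.

Lemma germ_comp d F G x s t : 0 < s ->
  germ d G x s -> germ d F (G x) t -> germ d (F \o G) x (t * s).
Proof.
move=> s0 [e e0 H] [e' e0' H'].
exists (Num.min e (e' / s)); first by rewrite lt_min e0 divr_gt0.
move=> h; rewrite le_min ler_pdivlMr// => /and3P[h0 he he'] /=.
by rewrite H ?h0// H' ?mulrA// mulr_ge0 ?(ltW s0)//= mulrC.
Qed.

Lemma germ_inv d f x s : 0 < s -> germ d f x s -> germ d (f^-1)%g (f x) s^-1.
Proof.
move=> s0 [e e0 H]; exists (s * e); first by rewrite mulr_gt0.
move=> h /andP[h0 he]; rewrite oautK.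
have := H (s^-1 * h); rewrite mulr_ge0 ?invr_ge0 ?(ltW s0)//=.
have -> : s^-1 * h <= e by rewrite mulrC ler_pdivrMr// mulrC.
by move=> /(_ isT); rewrite mulVKf ?gt_eqF// => <-; rewrite oaut_can.
Qed.

Lemma germ_fixX d f x s n : 0 < s -> f x = x ->
  germ d f x s -> germ d (f ^+ n)%g x (s ^+ n).
Proof.
move=> s0 fx fs; elim: n => [|n IH]; first exact: germ_id.
rewrite expgS exprS; apply: germ_comp; rewrite ?exprn_gt0//.
by rewrite oaut_fixX.
Qed.

(** Fixed points accumulate on one side of [x] only if the germ there is that of the
    identity. *)
Lemma germ_isolated d F x s : germ d F x s -> (F x = x -> s <> 1) ->
  exists2 e : R, 0 < e & forall h : R, 0 < h <= e ->
    F (x + (-1) ^+ d * h) <> x + (-1) ^+ d * h.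
Proof.
move=> [e e0 H] Fs.
have [Fx|/eqP Fx] := eqVneq (F x) x.
  exists e => // h /andP[h0 he]; rewrite H ?(ltW h0)// Fx.
  move/addrI/(mulfI (negbT (signr_eq0 R d))).
  rewrite -{2}[h]mul1r => /(mulIf (lt0r_neq0 h0)) s1.
  exact: Fs.
pose c := F x - x; have c0 : c != 0 by rewrite subr_eq0; apply/eqP.
have k0 : 0 < 1 + `|s - 1| by rewrite ltr_wpDr.
(* The displacement at distance [h] differs from [c] by at most [`|s - 1| * h]. *)
exists (Num.min e (`|c| / 2 / (1 + `|s - 1|))).
  by rewrite lt_min e0 !divr_gt0// normr_gt0.
move=> h; rewrite le_min ler_pdivlMr// => /and3P[h0 he hc].
rewrite H ?(ltW h0)// => E.
have {}E : c = - ((-1) ^+ d * ((s - 1) * h)).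
  by move: E; rewrite /c mulrBl mul1r mulrBr => E; lra.
have : `|c| = `|s - 1| * h.
  by rewrite E normrN normrM normr_sign mul1r normrM (gtr0_norm h0).
have : 0 < `|c| by rewrite normr_gt0.
move: hc; rewrite mulrDr mulr1 [h * _]mulrC => hc c1 c2; lra.
Qed.

End Germs.

(** * Piecewise linear groups *)

Section PLGroup.
Variable R : realType.
Variables A P : set R.
Hypothesis PG : positive_subgroup P.
Hypothesis AM : nonzero_submodule P A.
Implicit Types (f g : oaut R) (d : bool) (x s t : R).

Lemma subP_gt0 s : P s -> 0 < s. Proof. by case: PG => + _ _ _; exact. Qed.
Lemma subP1 : P 1. Proof. by case: PG. Qed.
Lemma subPM s t : P s -> P t -> P (s * t). Proof. by case: PG => _ _ + _; exact. Qed.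
Lemma subPV s : P s -> P s^-1. Proof. by case: PG => _ _ _; exact. Qed.
Lemma subA0 : A 0. Proof. by case: AM. Qed.
Lemma subAB x y : A x -> A y -> A (x - y). Proof. by case: AM => _ + _ _; exact. Qed.
Lemma subAN x : A x -> A (- x).
Proof. by rewrite -[- x]add0r; apply: subAB; exact: subA0. Qed.
Lemma subAD x y : A x -> A y -> A (x + y).
Proof. by move=> Ax /subAN Ay; rewrite -[y]opprK; exact: subAB. Qed.
Lemma subAM s x : P s -> A x -> A (s * x).
Proof. by case: AM => _ _ + _; exact. Qed.
Lemma subAMn x n : A x -> A (x *+ n).
Proof.
by move=> Ax; elim: n => [|n IH]; rewrite ?mulr0n ?mulrS; [exact: subA0|exact: subAD].
Qed.
Lemma subAMz x (m : int) : A x -> A (x *~ m).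
Proof. by move=> Ax; case: m => n; [|apply: subAN]; exact: subAMn. Qed.

(** The group of piecewise linear maps, described locally: in this form closure
    under composition and inversion is immediate, and global finiteness of the
    set of breakpoints is recovered by compactness for maps of bounded support. *)
Definition pl f : Prop :=
  [/\ forall x, A (f x) <-> A x,
      forall x d, exists2 s, P s & germ d f x s &
      forall x, ~ A x -> exists s, forall d, germ d f x s].

Lemma pl1 : pl 1%g.
Proof.
split=> // x => [d|_]; first by exists 1; [exact: subP1 | exact: germ_id].
by exists 1 => d; exact: germ_id.
Qed.

Lemma pl_germ_slope f x s d : pl f -> germ d f x s -> P s.
Proof. by move=> [_ + _] => /(_ x d)[t Pt ft] /(germ_uniq ft) <-. Qed.

Lemma plM f g : pl f -> pl g -> pl (f * g)%g.
Proof.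
move=> plf plg; have [fA fP fb] := plf; have [gA gP gb] := plg; split=> x.
- by rewrite oautME fA.
- move=> d; have [s Ps gs] := gP x d; have [t Pt ft] := fP (g x) d.
  by exists (t * s); [exact: subPM | apply: germ_comp (subP_gt0 Ps) _ _].
- move=> nAx; have [s gs] := gb x nAx; have [|t ft] := fb (g x); first by rewrite gA.
  have s0 : 0 < s by apply: subP_gt0; exact: (pl_germ_slope plg (gs true)).
  by exists (t * s) => d; apply: germ_comp.
Qed.

Lemma plV f : pl f -> pl (f^-1)%g.
Proof.
move=> plf; have [fA fP fb] := plf; split=> x.
- by rewrite -fA oautVK.
- move=> d; have [s Ps fs] := fP ((f^-1)%g x) d.
  exists s^-1; first exact: subPV.
  by rewrite -[x in germ _ _ x](oautVK f x); apply: germ_inv => //; exact: subP_gt0.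
- move=> nAx; have [|s fs] := fb ((f^-1)%g x); first by rewrite -fA oautVK.
  have s0 : 0 < s by apply: subP_gt0; exact: (pl_germ_slope plf (fs true)).
  by exists s^-1 => d; rewrite -[x in germ _ _ x](oautVK f x); exact: germ_inv.
Qed.

(** ** Bumps *)

(** Kinks are the building blocks of bumps. The inverse of a kink is a kink, which
    gives bijectivity, and the germs are of three kinds only: left of [c], at
    [c] and right of [c]. *)
Lemma kink_exists c s : A c -> P s ->
  exists2 f, pl f & f =1 fun x => if x <= c then x else c + s * (x - c).
Proof.
move=> Ac Ps; have s0 := subP_gt0 Ps.
pose k s x : R := if x <= c then x else c + s * (x - c).
have k_gt t x : 0 < t -> c < x -> k t x = c + t * (x - c) /\ c < k t x.
  move=> t0 cx; rewrite /k leNgt cx/=; split => //.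
  by rewrite ltrDl mulr_gt0// subr_gt0.
have k_le t x : x <= c -> k t x = x by rewrite /k => ->.
have kK t : 0 < t -> cancel (k t) (k t^-1).
  move=> t0 x; have [xc|cx] := leP x c; first by rewrite !k_le.
  have [E lt] := k_gt t x t0 cx; have [-> _] := k_gt t^-1 _ (etrans (invr_gt0 t) t0) lt.
  by rewrite E [c + t * _]addrC addrK mulKf ?gt_eqF// addrC subrK.
have km t : 0 < t -> {homo k t : x y / x < y}.
  move=> t0 x y xy; have [yc|cy] := leP y c.
    by rewrite !k_le// (le_trans (ltW xy)).
  have [E lt] := k_gt t y t0 cy; have [xc|cx] := leP x c.
    by rewrite (k_le t x xc) (le_lt_trans xc).
  have [-> _] := k_gt t x t0 cx; rewrite E ltrD2l ltr_pM2l//; lra.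
have kKV : cancel (k s^-1) (k s).
  by move=> x; have := kK s^-1; rewrite invr_gt0 invrK => ->.
pose f := Oaut (kK s s0) kKV (km s s0).
have gk d x : x < c \/ (x = c /\ d) -> germ d f x 1.
  move=> xc; exists (if x < c then c - x else 1).
    by case: ifP => //; rewrite subr_gt0.
  move=> h /andP[h0 he] /=; rewrite mul1r !k_le//.
    by case: xc => [/ltW//|[->]].
  case: xc he => [xc|[-> ->]]; last by rewrite expr1; lra.
  by rewrite xc; case: d; rewrite ?expr1 ?expr0; lra.
have gk' d x : c < x \/ (x = c /\ d = false) -> germ d f x s.
  move=> cx; exists (if c < x then (x - c) / 2 else 1).
    by case: ifP => // {}cx; rewrite divr_gt0// subr_gt0.
  have ks y : c <= y -> k s y = c + s * (y - c).
    rewrite le_eqVlt => /predU1P[<-|cy]; first by rewrite k_le// subrr mulr0 addr0.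
    by have [] := k_gt s y s0 cy.
  have cx' : c <= x by case: cx => [/ltW//|[->]].
  move=> h /andP[h0 he] /=; rewrite !ks//; first by ring.
  case: cx he {cx'} => [cx|[-> ->]]; last by rewrite expr0; lra.
  by rewrite cx; case: d; rewrite ?expr1 ?expr0; lra.
exists f => //; split=> x.
- have kA t y : P t -> A y -> A (k t y).
    move=> Pt Ay; rewrite /k; case: ifP => // _.
    by apply: subAD => //; apply: subAM => //; exact: subAB.
  split; last exact: kA.
  by move=> /(kA _ _ (subPV Ps)); rewrite /= kK.
- move=> d; case: (ltgtP x c) => xc.
  + by exists 1; [exact: subP1 | apply: gk; left].
  + by exists s => //; apply: gk'; left.
  + case: d; last by exists s => //; apply: gk'; right.
    by exists 1; [exact: subP1 | apply: gk; right].
- case: (ltgtP x c) => xc nAx.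
  + by exists 1 => d; apply: gk; left.
  + by exists s => d; apply: gk'; left.
  + by rewrite xc in nAx.
Qed.

(** A product of kinks at [l], at the image of [x0] and at [r], with ratios [a^-1],
    [a * b] and [b^-1]. The images of [l, x0] and [x0, r] have lengths [(b - 1) * c]
    and [b * (a - 1) * c], whose sum is [r - l]: this is why [r] is fixed, and why the
    length of the support is taken in [(a * b - 1) * A]. *)
Lemma bump_exists a b l c : P a -> P b -> 1 < a -> 1 < b -> A l -> A c -> 0 < c ->
  let r := l + (a * b - 1) * c in let x0 := l + a * (b - 1) * c in
  exists f, [/\ pl f, forall x, x <= l \/ r <= x -> f x = x,
    forall x, l <= x <= x0 -> f x = l + a^-1 * (x - l) &
    forall x, x0 <= x <= r -> f x = r - b * (r - x)].
Proof.
move=> Pa Pb a1 b1 Al Ac c0 r x0.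
have a0 : 0 < a := subP_gt0 Pa; have b0 : 0 < b := subP_gt0 Pb.
have Am t x : P t -> A x -> A ((t - 1) * x).
  by move=> Pt Ax; rewrite mulrBl mul1r; apply: subAB => //; exact: subAM.
have Ar : A r by apply: subAD => //; apply: Am => //; exact: subPM.
pose y0 := l + (b - 1) * c.
have Ay : A y0 by apply: subAD => //; exact: Am.
have [f1 pf1 f1E] := kink_exists Al (subPV Pa).
have [f2 pf2 f2E] := kink_exists Ay (subPM Pa Pb).
have [f3 pf3 f3E] := kink_exists Ar (subPV Pb).
have bc0 : 0 < (b - 1) * c by rewrite mulr_gt0// subr_gt0.
have ac0 : 0 < b * (a - 1) * c by rewrite !mulr_gt0// subr_gt0.
have ry : r = y0 + b * (a - 1) * c by rewrite /r /y0; ring.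
have x0y : x0 = l + a * (y0 - l) by rewrite /x0 /y0; ring.
have aV x : a^-1 * x <= y0 - l <-> x <= x0 - l.
  rewrite mulrC ler_pdivrMr// mulrC x0y.
  by split => H; lra.
have f1l x : x <= l -> f1 x = x by rewrite f1E => ->.
have f1r x : l <= x -> f1 x = l + a^-1 * (x - l).
  rewrite f1E le_eqVlt => /predU1P[<-|]; first by rewrite lexx subrr mulr0 addr0.
  by rewrite ltNge => /negbTE ->.
have f2l x : x <= y0 -> f2 x = x by rewrite f2E => ->.
have f2r x : y0 <= x -> f2 x = y0 + a * b * (x - y0).
  rewrite f2E le_eqVlt => /predU1P[<-|]; first by rewrite lexx subrr mulr0 addr0.
  by rewrite ltNge => /negbTE ->.
have f3l x : x <= r -> f3 x = x by rewrite f3E => ->.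
have f3r x : r <= x -> f3 x = r + b^-1 * (x - r).
  rewrite f3E le_eqVlt => /predU1P[<-|]; first by rewrite lexx subrr mulr0 addr0.
  by rewrite ltNge => /negbTE ->.
have ly : l < y0 by rewrite /y0 ltrDl.
have yr : y0 < r by rewrite ry ltrDl.
have lx : l < x0 by rewrite x0y ltrDl mulr_gt0// subr_gt0.
have f21 x : x0 <= x -> (f2 * f1)%g x = r - b * (r - x).
  move=> xx; rewrite oautME f1r; last lra.
  rewrite f2r.
    apply: (mulfI (lt0r_neq0 a0)); rewrite /r /y0; field; lra.
  rewrite -lerBlDl leNgt; apply/negP => H.
  have : a^-1 * (x - l) < a^-1 * (x0 - l).
    by rewrite x0y [l + _ - l]addrC addKr mulKf ?gt_eqF.
  rewrite ltr_pM2l ?invr_gt0//; lra.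
exists (f3 * (f2 * f1))%g; split.
- by apply: plM => //; exact: plM.
- move=> x [xl|rx].
    by rewrite oautME oautME f1l// f2l ?f3l//; lra.
  have x0r : x0 <= x.
    apply: le_trans rx; rewrite /x0 /r lerD2l.
    rewrite ler_pM2r//; lra.
  have H : b * (r - x) <= 0 by rewrite pmulr_rle0// subr_le0.
  rewrite oautME f21// f3r; last lra.
  by rewrite [r - _]addrC addrK mulrN mulKf ?gt_eqF//; ring.
- move=> x /andP[lx' xx]; rewrite oautME oautME f1r//.
  have /aV H : x - l <= x0 - l by rewrite lerD2r.
  by rewrite f2l ?f3l//; lra.
- move=> x /andP[xx xr]; rewrite oautME f21// f3l//.
  rewrite lerBlDr lerDl mulr_ge0// ?(ltW b0)//; lra.
Qed.
End PLGroup.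

(** * Actions with dyadic germs *)

Section Dynamics.
Variable R : realType.
Implicit Types (f g h b z : oaut R) (H N : set (oaut R)).

Definition subgroup H : Prop :=
  [/\ H 1%g, forall f g, H f -> H g -> H (f * g)%g & forall f, H f -> H (f^-1)%g].

Definition normal_subgroup N H : Prop :=
  [/\ subgroup N, N `<=` H & forall h z, H h -> N z -> N (z ^ h)%g].

Lemma subgroupJ H f g : subgroup H -> H f -> H g -> H (f ^ g)%g.
Proof. by move=> [_ HM HV] Hf Hg; rewrite conjgE; apply: (HM); [exact: HV|exact: HM]. Qed.

Lemma subgroupX H f n : subgroup H -> H f -> H (f ^+ n)%g.
Proof.
by move=> [H1 HM _] Hf; elim: n => [//|n IH]; rewrite expgS; exact: HM.
Qed.

Lemma subgroupR H f g : subgroup H -> H f -> H g -> H [~ f, g]%g.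
Proof.
move=> HG Hf Hg; have [_ HM HV] := HG; rewrite commgEl.
by apply: HM; [exact: HV | exact: subgroupJ].
Qed.

Definition dyadic_germs f : Prop := forall x d, exists k : int, germ d f x (2 ^ k).

Lemma exp2z_gt0 (k : int) : 0 < 2 ^ k :> R.
Proof. by rewrite exprz_gt0. Qed.

(** The group of dyadic germs at a fixed point is cyclic: if the slopes are [2 ^ k]
    and [2 ^ l], the exponents [`|l|] and [`|k|] cancel, up to the sign of [k * l]. *)
Lemma dyadic_germ_relation d f g u : dyadic_germs f -> dyadic_germs g ->
  f u = u -> g u = u -> exists m n, (0 < m + n)%N /\
  (germ d (f ^+ m * g ^+ n)%g u 1 \/ germ d (f ^+ m * g ^- n)%g u 1).
Proof.
move=> df dg fu gu.
have [k fk] := df u d; have [l gl] := dg u d.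
have fX m : germ d (f ^+ m)%g u (2 ^ (k * m%:Z)).
  by rewrite -exprz_exp; apply: germ_fixX => //; exact: exp2z_gt0.
have gX n : germ d (g ^+ n)%g u (2 ^ (l * n%:Z)).
  by rewrite -exprz_exp; apply: germ_fixX => //; exact: exp2z_gt0.
have gXV n : germ d (g ^- n)%g u (2 ^ (- (l * n%:Z))).
  rewrite -invr_expz -[u in germ _ _ u](oaut_fixX n gu).
  by apply: germ_inv => //; exact: exp2z_gt0.
have pos m n : k * m%:Z + l * n%:Z = 0 -> germ d (f ^+ m * g ^+ n)%g u 1.
  move=> kl; have -> : (1 : R) = 2 ^ (k * m%:Z) * 2 ^ (l * n%:Z).
    by rewrite -expfzDr ?kl// pnatr_eq0.
  by apply: germ_comp; rewrite ?exp2z_gt0 ?oaut_fixX.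
have neg m n : k * m%:Z - l * n%:Z = 0 -> germ d (f ^+ m * g ^- n)%g u 1.
  move=> kl; have -> : (1 : R) = 2 ^ (k * m%:Z) * 2 ^ (- (l * n%:Z)).
    by rewrite -expfzDr ?kl// pnatr_eq0.
  by apply: germ_comp; rewrite ?exp2z_gt0// ?(oaut_fixV (oaut_fixX n gu))//.
have [k0|k0] := eqVneq k 0.
  by exists 1%N, 0%N; split => //; left; apply: pos; rewrite k0; lia.
exists `|l|%N, `|k|%N; split; first by lia.
have [klp|klp] := lerP 0 (k * l); [right; apply: neg|left; apply: pos]; nia.
Qed.

Section Embedding.
Variables (H : set (oaut R)) (Phi : oaut R -> oaut R) (c d : R).
Hypothesis HG : subgroup H.
Hypothesis PhiM : forall f g, H f -> H g -> Phi (f * g)%g = (Phi f * Phi g)%g.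
Hypothesis Phi_supp : forall f x, H f -> ~~ (c <= x <= d) -> Phi f x = x.
Hypothesis Phi_dyadic : forall f, H f -> dyadic_germs (Phi f).

Let H1 : H 1%g. Proof. by case: HG. Qed.
Let HM f g : H f -> H g -> H (f * g)%g. Proof. by case: HG => _ + _; exact. Qed.
Let HV f : H f -> H (f^-1)%g. Proof. by case: HG => _ _; exact. Qed.

Lemma Phi1 : Phi 1%g = 1%g.
Proof. by apply: (mulgI (Phi 1%g)); rewrite -PhiM// !mulg1. Qed.

Lemma PhiV f : H f -> Phi (f^-1)%g = ((Phi f)^-1)%g.
Proof.
move=> Hf; apply: (mulgI (Phi f)).
by rewrite mulgV -PhiM ?mulgV ?Phi1//; exact: HV.
Qed.

Lemma PhiX f n : H f -> Phi (f ^+ n)%g = (Phi f ^+ n)%g.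
Proof.
move=> Hf; elim: n => [|n IH]; first exact: Phi1.
by rewrite !expgS PhiM ?IH//; exact: subgroupX.
Qed.

Lemma PhiJ f g : H f -> H g -> Phi (f ^ g)%g = (Phi f ^ Phi g)%g.
Proof. by move=> Hf Hg; rewrite !conjgE !PhiM ?PhiV//; auto. Qed.

Lemma PhiR f g : H f -> H g -> Phi [~ f, g]%g = [~ Phi f, Phi g]%g.
Proof.
by move=> Hf Hg; rewrite !commgEl PhiM ?PhiV ?PhiJ//; [exact: HV|exact: subgroupJ].
Qed.

(** Taking slopes at a common fixed point is a homomorphism to a commutative
    group. *)
Lemma germ_commutator s f g u : H f -> H g -> Phi f u = u -> Phi g u = u ->
  germ s (Phi [~ f, g]%g) u 1.
Proof.
move=> Hf Hg fu gu.
have [k fk] := Phi_dyadic Hf u s; have [l gl] := Phi_dyadic Hg u s.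
have k0 := exp2z_gt0 k; have l0 := exp2z_gt0 l.
have fV : germ s ((Phi f)^-1)%g u (2 ^ k)^-1.
  by rewrite -[u in germ _ _ u]fu; exact: germ_inv.
have gV : germ s ((Phi g)^-1)%g u (2 ^ l)^-1.
  by rewrite -[u in germ _ _ u]gu; exact: germ_inv.
rewrite PhiR// commgEl conjgE.
have -> : (1 : R) = (2 ^ k)^-1 * ((2 ^ l)^-1 * (2 ^ k * 2 ^ l)).
  by field; rewrite !gt_eqF.
apply: germ_comp; first by rewrite !mulr_gt0 ?invr_gt0.
  apply: germ_comp; first by rewrite mulr_gt0.
    by apply: germ_comp; rewrite ?gu.
  by rewrite oautME gu fu.
by rewrite !oautME gu fu oaut_fixV.
Qed.

Variables (b0 f g : oaut R).
Hypothesis Hb0 : H b0.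
Hypothesis Phi_b0 : Phi b0 <> 1%g.
Hypothesis b0_min : forall N, normal_subgroup N H ->
  (exists2 z, N z & z <> 1%g) -> N b0.
Hypotheses (Hf : H f) (Hg : H g).

(** The action restricted to the convex hull [u, v] of an orbit on which [b0]
    acts nontrivially is faithful. Near [u] some word [w] in [f] and [g] acts
    trivially, near [v] commutators do; as the orbit accumulates on [u] and [v], an
    element of [H] carries the supports of finitely many commutators into the
    set of points fixed by [w]. *)
Lemma commutators_displaced : exists m n w, [/\ (0 < m + n)%N,
  w = (f ^+ m * g ^+ n)%g \/ w = (f ^+ m * g ^- n)%g &
  forall D : seq (oaut R),
    (forall b, b \in D -> exists x y, [/\ H x, H y & b = [~ x, y]%g]) ->
    exists2 h, H h & forall b, b \in D -> commute w (b ^ h)%g].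
Proof.
have [x bx] : exists x, Phi b0 x <> x.
  apply: contrapT => /forallNP nx; apply: Phi_b0.
  by apply: oaut_ext => x; apply: contrapT; exact: nx.
have Hcd y h : H h -> c <= y <= d -> c <= Phi h y <= d.
  move=> Hh ycd; apply: contrapT => /negP nP.
  have /oautI E := Phi_supp Hh nP.
  by move: nP; rewrite E ycd.
have xcd : c <= x <= d by apply: contrapT => /negP /(Phi_supp Hb0).
pose S := [set Phi h x | h in H].
have Sx : S x by exists 1%g => //; rewrite Phi1.
have Scd y : S y -> c <= y <= d by move=> [h Hh <-]; exact: Hcd.
have supS : has_sup S by split; [exists x | exists d => y /Scd/andP[]].
have infS : has_inf S by split; [exists x | exists c => y /Scd/andP[]].
have SH h y : H h -> S y -> S (Phi h y).
  by move=> Hh [k Hk <-]; exists (h * k)%g; [exact: HM | rewrite PhiM].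
pose u := inf S; pose v := sup S.
have SHV h y : H h -> S y -> S ((Phi h)^-1%g y).
  by move=> Hh Sy; rewrite -PhiV//; apply: SH => //; exact: HV.
have fix_u h : H h -> Phi h u = u by move=> Hh; apply: oaut_fix_inf => // y; auto.
have fix_v h : H h -> Phi h v = v by move=> Hh; apply: oaut_fix_sup => // y; auto.
have ux : u <= x by apply: ge_inf => //; case: infS.
have xv : x <= v by apply: ub_le_sup => //; case: supS.
(* The kernel [N] of the action on [u, v] is trivial, as it misses [b0]. *)
pose N := [set h | H h /\ forall y, u <= y <= v -> Phi h y = y].
have NN : normal_subgroup N H.
  split; [split| by move=> h []|].
  - by split => // y _; rewrite Phi1.
  - move=> h k [Hh hE] [Hk kE]; split; first exact: HM.
    by move=> y yuv; rewrite PhiM// oautME kE ?hE.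
  - move=> h [Hh hE]; split; first exact: HV.
    by move=> y yuv; rewrite PhiV// oaut_fixV// hE.
  - move=> h z Hh [Hz zE]; split; first exact: subgroupJ.
    move=> y /andP[uy yv]; rewrite PhiJ// conjgE !oautME zE ?oautK//.
    by rewrite -[leLHS](fix_u h Hh) -[in X in _ && X](fix_v h Hh) !oaut_leE uy.
have N1 z : H z -> (forall y, u <= y <= v -> Phi z y = y) -> z = 1%g.
  move=> Hz zE; apply: contrapT => z1.
  have [_ b0E] : N b0 by apply: b0_min => //; exists z.
  by apply: bx; apply: b0E; rewrite ux.
have [m [n [mn gw]]] :=
  dyadic_germ_relation false (Phi_dyadic Hf) (Phi_dyadic Hg) (fix_u f Hf) (fix_u g Hg).
have [w [Hw wE {}gw]] : exists w, [/\ H w,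
    w = (f ^+ m * g ^+ n)%g \/ w = (f ^+ m * g ^- n)%g & germ false (Phi w) u 1].
  have HfX := subgroupX m HG Hf; have HgX := subgroupX n HG Hg.
  case: gw => gw; [exists (f ^+ m * g ^+ n)%g | exists (f ^+ m * g ^- n)%g]; split.
  - exact: HM.
  - by left.
  - by rewrite PhiM// !PhiX.
  - by apply: HM => //; exact: HV.
  - by right.
  - by rewrite PhiM ?PhiV ?PhiX//; exact: HV.
exists m, n, w; split => // D Dcomm.
have [e e0 we] : exists2 e : R, 0 < e & forall y, u <= y <= u + e -> Phi w y = y.
  case: gw => e e0 we; exists e => // y /andP[uy ye].
  have := we (y - u); rewrite expr0 !mul1r fix_u// [u + _]addrC subrK; apply; lra.
have [t t0 Dt] : exists2 t : R, 0 < t & forall b, b \in D ->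
    H b /\ forall y, v - t <= y <= v -> Phi b y = y.
  elim: D Dcomm => [_|b D IH Dcomm]; first by exists 1.
  have [|t t0 Dt] := IH; first by move=> b' Db'; apply: Dcomm; rewrite inE Db' orbT.
  have [y [z [Hy Hz bE]]] := Dcomm b (mem_head _ _).
  have [t' t'0 bt] := germ_commutator true Hy Hz (fix_v y Hy) (fix_v z Hz).
  have Hb : H b by rewrite bE; exact: subgroupR.
  exists (Num.min t t'); first by rewrite lt_min t0.
  move=> b'; rewrite inE => /predU1P[->|Db'].
    split => // r /andP[rv rv']; have := bt (v - r).
    rewrite -bE expr1 !mulN1r mul1r fix_v// opprB [v + (r - v)]addrC subrK; apply.
    have : v - t' <= v - Num.min t t' by rewrite lerD2l lerN2 ge_min lexx orbT.
    lra.
  have [Hb' tb'] := Dt b' Db'; split => // r /andP[rv rv']; apply: tb'.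
  have : v - t <= v - Num.min t t' by rewrite lerD2l lerN2 ge_min lexx.
  lra.
have [_ [h1 Hh1 <-] h1v] : exists2 y, S y & v - t < y.
  by apply: sup_gt; [case: supS | rewrite ltrBlDr ltrDl].
have [_ [h2 Hh2 <-] h2u] : exists2 y, S y & y < u + e.
  by apply: inf_lt; [case: infS | rewrite ltrDl].
(* [Phi h] maps a point below [u + e] to a point above [v - t]. *)
pose h := (h1 * h2^-1)%g.
have Hh : H h by apply: HM => //; exact: HV.
exists h => // b /Dt[Hb bE].
have Hbh : H (b ^ h)%g by exact: subgroupJ.
pose p := (Phi h)^-1%g (v - t).
have pe : p < u + e.
  rewrite /p -oaut_gtV /h PhiM ?PhiV ?oautME//; last exact: HV.
  rewrite (lt_trans h1v)// oaut_ltE -{1}[x](oautK (Phi h2)) oaut_ltE.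
  exact: h2u.
have bhE y : p <= y <= v -> Phi (b ^ h)%g y = y.
  move=> /andP[py yv]; rewrite PhiJ// conjgE !oautME bE ?oautK//.
  by rewrite oaut_geV py -[v in _ <= v](fix_v h Hh) oaut_leE.
apply/commgP/eqP; apply: N1; first exact: subgroupR.
move=> y /andP[uy yv]; rewrite PhiR// commgEl conjgE.
suff E : Phi w (Phi (b ^ h)%g y) = Phi (b ^ h)%g (Phi w y).
  by rewrite !oautME E !oautK.
(* Left of [u + e] the map [Phi w] is the identity and [Phi (b ^ h)] preserves
   [u, u + e]; right of [u + e] the roles are exchanged. *)
have [ye|ey] := leP y (u + e).
  rewrite (we y) ?uy//; have [py|yp] := leP p y; first by rewrite bhE ?py// we ?uy.
  rewrite we// -[u in u <= _](fix_u _ Hbh) oaut_leE uy/=.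
  rewrite (le_trans _ (ltW pe))//.
  have [pv|vp] := leP p v; first by rewrite -[p in _ <= p]bhE ?lexx ?pv// oaut_leE ltW.
  by rewrite (le_trans _ (ltW vp))// -[v in _ <= v](fix_v _ Hbh) oaut_leE.
rewrite (bhE y) ?yv ?(ltW (lt_trans pe ey))//.
rewrite bhE// -[in X in _ && X](fix_v _ Hw) oaut_leE yv andbT.
have wue : Phi w (u + e) = u + e by apply: we; rewrite lexx andbT lerDl ltW.
by rewrite (le_trans (ltW pe))// -[leLHS]wue oaut_leE ltW.
Qed.

End Embedding.
End Dynamics.

(** * Elements of piecewise linear groups *)

(** Compactness in a one-sided form that matches germs; it is used both for
    breakpoints and for fixed points. *)
Lemma discrete_segment_finite (R : realType) (S : set R) (p q : R) :
  (forall x, S x -> p <= x <= q) ->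
  (forall z (d : bool), p <= z <= q -> exists2 e : R, 0 < e &
    forall h : R, 0 < h <= e -> ~ S (z + (-1) ^+ d * h)) ->
  finite_set S.
Proof.
move=> Spq Siso; apply: contrapT => infS.
have [|z zS] := infinite_bounded_limit_point_nonempty infS.
  exists (`|p| + `|q|); split; first exact: num_real.
  move=> M ltM x /Spq/andP[px xq] /=; rewrite ler_norml.
  have := ler_norm q; have := ler_norm (- p); rewrite normrN.
  have := normr_ge0 p; have := normr_ge0 q.
  by move=> *; apply/andP; split; lra.
have near_z (e : R) : 0 < e -> exists y, [/\ y != z, S y & `|z - y| < e].
  by move=> e0; have := zS _ (nbhsx_ballx z e e0) => -[y [yz Sy zy]]; exists y.
have zpq : p <= z <= q.
  apply/andP; split; rewrite leNgt; apply/negP => zlt.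
    have [|y [_ /Spq/andP[py _]]] := near_z (p - z); first by rewrite subr_gt0.
    by rewrite ltr_norml; lra.
  have [|y [_ /Spq/andP[_ yq]]] := near_z (z - q); first by rewrite subr_gt0.
  by rewrite ltr_norml; lra.
have [e0 e0p He0] := Siso z false zpq; have [e1 e1p He1] := Siso z true zpq.
have [|y [yz Sy]] := near_z (Num.min e0 e1); first by rewrite lt_min e0p.
rewrite lt_min => /andP[zy0 zy1].
have [zy|yz'|yE] := ltgtP z y; last by rewrite yE eqxx in yz.
  apply: (He0 (y - z)); last by rewrite expr0 mul1r addrC subrK.
  by move: zy0; rewrite ltr_norml; lra.
apply: (He1 (z - y)); last by rewrite expr1 mulN1r opprB addrC subrK.
by move: zy1; rewrite ltr_norml; lra.
Qed.

(** Bernoulli's inequality. *)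
Lemma exprn_unbounded (R : realType) (a y : R) : 1 < a -> exists n, y < a ^+ n.
Proof.
move=> a1; have ge n : 1 + (a - 1) *+ n <= a ^+ n.
  elim: n => [|n IH]; first by rewrite mulr0n addr0 expr0.
  have : 0 <= (a - 1) * ((a - 1) *+ n).
    by rewrite mulr_ge0 ?mulrn_wge0//; lra.
  have : a * (1 + (a - 1) *+ n) <= a ^+ n.+1.
    by rewrite exprS ler_pM2l//; lra.
  by rewrite mulrS; lra.
have [n yn] : exists n : nat, y / (a - 1) < n%:R.
  exists (Num.truncn (`|y / (a - 1)|)).+1.
  by rewrite (le_lt_trans (ler_norm _))// truncnS_gt.
exists n; apply: lt_le_trans (ge n).
move: yn; rewrite ltr_pdivrMr ?subr_gt0// mulr_natl; lra.
Qed.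

(** Multiplying a positive element of [A] by a large power of [a^-1] gives arbitrarily
    small elements [t]; multiples of [t] then meet every interval. The factor [k]
    serves for the lengths of the supports of bumps. *)
Lemma submodule_dense (R : realType) (A P : set R) (a k y1 y2 : R) :
  positive_subgroup P -> nonzero_submodule P A -> P a -> 1 < a -> 0 < k ->
  y1 < y2 -> exists2 c, A c & y1 < k * c < y2.
Proof.
move=> PG AM Pa a1 k0 y12.
have [x Ax x0] : exists2 x, A x & 0 < x.
  have [_ _ _ [x Ax]] := AM; rewrite neq_lt => /orP[x0|x0]; last by exists x.
  by exists (- x); rewrite ?oppr_gt0//; exact: (subAN AM).
have a0 : 0 < a by lra.
have [n nE] := exprn_unbounded (k * x / (y2 - y1)) a1.
pose t := (a ^+ n)^-1 * x.
have At : A t.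
  apply: (subAM AM) => //; apply: (subPV PG).
  by elim: (n) => [|m IH]; rewrite ?expr0 ?exprS; [exact: (subP1 PG)|exact: (subPM PG)].
have t0 : 0 < k * t by rewrite !mulr_gt0// invr_gt0 exprn_gt0.
have ty : k * t < y2 - y1.
  rewrite /t mulrCA mulrC ltr_pdivrMr ?exprn_gt0//.
  by move: nE; rewrite ltr_pdivrMr ?subr_gt0// [_ * (y2 - y1)]mulrC.
pose m := Num.floor (y1 / (k * t)).
exists (t *~ (m + 1)); first exact: (subAMz AM).
have := floorD1_gt (y1 / (k * t)); have := floor_le (y1 / (k * t)).
rewrite -/m ler_pdivlMr// ltr_pdivrMr// intrD => H1 H2.
have -> : k * (t *~ (m + 1)) = m%:~R * (k * t) + k * t.
  by rewrite -mulrzr intrD; ring.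
have {}H2 : y1 < m%:~R * (k * t) + k * t by move: H2; rewrite mulrDl mul1r.
by apply/andP; split; lra.
Qed.

Section Supports.
Variable R : realType.
Implicit Types (f g h b c w : oaut R) (p q : R).

Definition supp_in p q f : Prop := forall x, x <= p \/ q <= x -> f x = x.

Lemma supp_in1 p q : supp_in p q 1%g. Proof. by []. Qed.

Lemma supp_inM p q f g : supp_in p q f -> supp_in p q g -> supp_in p q (f * g)%g.
Proof. by move=> Hf Hg x Hx; rewrite oautME Hg ?Hf. Qed.

Lemma supp_inV p q f : supp_in p q f -> supp_in p q (f^-1)%g.
Proof. by move=> Hf x Hx; rewrite oaut_fixV ?Hf. Qed.

Lemma supp_inS p q p' q' f : p' <= p -> q <= q' -> supp_in p q f -> supp_in p' q' f.
Proof. by move=> pp qq Hf x Hx; apply: Hf; lra. Qed.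

Lemma supp_inJ p q f g : supp_in p q f ->
  supp_in ((g^-1)%g p) ((g^-1)%g q) (f ^ g)%g.
Proof.
move=> Hf x Hx; rewrite conjgE !oautME Hf ?oautK//.
by case: Hx => Hx; [left; rewrite oaut_leV | right; rewrite oaut_geV].
Qed.

Lemma commgMl_commute f g h : commute g h -> [~ f * g, h]%g = ([~ f, h] ^ g)%g.
Proof.
move=> /commgP/conjg_fixP gh.
by rewrite !commgEl conjMg invgM gh [RHS]conjgE !mulgA.
Qed.

Lemma disjoint_commute a f g :
  (forall x, a <= x -> f x = x) -> (forall x, x <= a -> g x = x) -> commute f g.
Proof.
move=> fa ga; apply: oaut_ext => x; rewrite !oautME.
have [ax|/ltW xa] := leP a x.
  by rewrite (fa x)// fa// -(ga a) ?oaut_leE.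
by rewrite (ga x)// ga// -[leRHS](fa a) ?oaut_leE.
Qed.

Lemma commute_fix_sup b w : commute w b ->
  has_sup [set x | b x <> x] -> w (sup [set x | b x <> x]) = sup [set x | b x <> x].
Proof.
have stable v x : commute v b -> b x <> x -> b (v x) <> v x.
  move=> wb bx; rewrite -oautME -wb oautME; apply: contra_not bx; exact: oautI.
move=> wb Hs; apply: oaut_fix_sup => // x; apply: stable => //.
by apply: commute_sym; apply: commuteV; exact: commute_sym.
Qed.

End Supports.
Arguments supp_inJ {R p q f} g _ x _.

(** For [a] and [b] greater than 1, this says that they generate a free abelian group
    of rank 2: a relation [a ^+ m * b ^+ n = 1] holds only for [m = n = 0] anyway. *)
Definition multiplicatively_independent (R : realType) (a b : R) : Prop :=
  forall m n : nat, a ^+ m = b ^+ n -> m = 0%N /\ n = 0%N.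

Section PLElements.
Variable R : realType.
Variables (A P : set R) (a b p c : R).
Hypothesis PG : positive_subgroup P.
Hypothesis AM : nonzero_submodule P A.
Hypotheses (Pa : P a) (Pb : P b) (a1 : 1 < a) (b1 : 1 < b).
Hypotheses (Ap : A p) (Ac : A c) (c0 : 0 < c).
Implicit Types (f g h z w : oaut R) (d : bool).

Let k := a * b - 1.
Let q := p + k * c.
Let k0 : 0 < k. Proof. by rewrite /k; have := mulr_egt1 a1 b1; lra. Qed.
Let pq : p < q. Proof. by rewrite /q ltrDl mulr_gt0. Qed.

Definition pl_supp : set (oaut R) := [set f | pl A P f /\ supp_in p q f].

Lemma pl_supp_group : subgroup pl_supp.
Proof.
split; first by split; [exact: pl1 | exact: supp_in1].
- by move=> f g [pf sf] [pg sg]; split; [exact: plM | exact: supp_inM].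
- by move=> f [pf sf]; split; [exact: plV | exact: supp_inV].
Qed.
Let HG := pl_supp_group.

Lemma pl_supp_fix f : pl_supp f -> f p = p /\ f q = q.
Proof. by move=> [_ sf]; rewrite !sf//; [right|left]. Qed.

Lemma pl_supp_stable f x : pl_supp f -> p < x < q -> p < f x < q.
Proof.
move=> /pl_supp_fix[fp fq] /andP[px xq].
by rewrite -[ltLHS]fp -[in X in _ && X]fq !oaut_ltE px.
Qed.

(** The germ at [x] on the side [d] lies in [p, q]. At the end points only one germ
    does, and the slopes of bumps are controlled for that germ only. *)
Definition inner_side d x := if d then p < x <= q else p <= x < q.

Lemma germ_affine F (l r s x : R) d : (forall y, l <= y <= r -> F y = F l + s * (y - l)) ->
  (if d then l < x <= r else l <= x < r) -> germ d F x s.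
Proof.
move=> FE Hx; exists (if d then x - l else r - x).
  by case: d Hx; lra.
move=> h /andP[h0 he]; rewrite FE; last first.
  by case: d Hx he; rewrite ?expr1 ?expr0; lra.
by rewrite (FE x); [ring | case: d Hx he; lra].
Qed.


Lemma bump_in l e : A l -> A e -> 0 < e -> p <= l -> l + k * e <= q ->
  exists f, [/\ pl_supp f, supp_in l (l + k * e) f &
    forall x, l < x < l + k * e -> f x < x].
Proof.
have [a1' b1' k0' pq'] := And4 a1 b1 k0 pq.
move=> Al Ae e0 pl lq.
have := bump_exists PG AM Pa Pb a1 b1 Al Ae e0.
rewrite -/k; set r := l + k * e in lq *; move=> [f [plf fs fl fr]].
exists f; split => //; first by split => //; apply: supp_inS fs.
move=> x /andP[lx xr]; have [xx|xx] := leP x (l + a * (b - 1) * e).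
  rewrite fl ?(ltW lx)// -ltrBrDl mulrC ltr_pdivrMr; last lra.
  by rewrite ltr_pMr ?subr_gt0.
rewrite fr ?(ltW xr) ?(ltW xx)//.
have : 0 < (b - 1) * (r - x) by apply: mulr_gt0; lra.
lra.
Qed.

Lemma bump_full s t : (s = a /\ t = b) \/ (s = b /\ t = a) ->
  exists f, [/\ pl_supp f, forall x, p < x < q -> f x < x &
    forall x d, inner_side d x -> germ d f x s^-1 \/ germ d f x t].
Proof.
have [a1' b1' k0' pq'] := And4 a1 b1 k0 pq.
move=> st.
have [Ps Pt s1 t1] : [/\ P s, P t, 1 < s & 1 < t] by case: st => -[-> ->].
have stq : p + (s * t - 1) * c = q.
  by case: st => -[-> ->]; rewrite /q /k// [b * a]mulrC.
have := bump_exists PG AM Ps Pt s1 t1 Ap Ac c0; rewrite stq.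
set x0 := p + _; move=> [f [plf fs fl fr]].
have px0 : p < x0 by rewrite ltrDl !mulr_gt0//; lra.
have x0q : x0 < q.
  by rewrite -stq ltrD2l ltr_pM2r//; lra.
exists f; split => //.
- move=> x /andP[lx xr]; have [xx|xx] := leP x x0.
    rewrite fl ?(ltW lx)// -ltrBrDl mulrC ltr_pdivrMr; last lra.
    by rewrite ltr_pMr ?subr_gt0.
  rewrite fr ?(ltW xr) ?(ltW xx)//.
  have : 0 < (t - 1) * (q - x) by apply: mulr_gt0; lra.
  lra.
- have fp : f p = p by apply: fs; left.
  have {}fl : forall y, p <= y <= x0 -> f y = f p + s^-1 * (y - p).
    by move=> y /fl ->; rewrite fp.
  have {}fr : forall y, x0 <= y <= q -> f y = f x0 + t * (y - x0).
    move=> y yq; rewrite fr// (fr x0) ?lexx ?(ltW x0q)//; ring.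
  move=> x d; rewrite /inner_side => Hx.
  have [xx|xx] : (if d then p < x <= x0 else p <= x < x0) \/
                 (if d then x0 < x <= q else x0 <= x < q).
    case: d Hx => /andP[px xq].
      by have [xx|xx] := leP x x0; [left; rewrite px | right].
    by have [xx|xx] := ltP x x0; [left; rewrite px | right].
  + by left; apply: germ_affine xx.
  + by right; apply: germ_affine xx.
Qed.

(** A power of the inverse of a full bump pushes [s, t] to the right of [y1]; then a
    power of a bump supported in [y1, r], with [r] beyond the image of [t],
    contracts towards [y1]. *)
Lemma squeeze y1 y2 s t : A y1 -> p < y1 < q -> y1 < y2 -> p < s -> t < q ->
  exists h, [/\ pl_supp h, y1 < h s & h t < y2].
Proof.
have [a1' b1' k0' pq'] := And4 a1 b1 k0 pq.
move=> Ay /andP[py yq] y12 ps tq.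
have [f [Hf fdown _]] := bump_full (or_introl (conj erefl erefl)).
have [_ fq] := pl_supp_fix Hf.
have [_ HM HV] := HG.
have fup x : p < x < q -> x < (f^-1)%g x.
  by move=> xpq; rewrite -oaut_ltV fdown.
have [n ns] := oaut_climb (oaut_fixV fq) fup ps yq.
pose f' := (f^-1 ^+ n)%g.
have Hf' : pl_supp f' by apply: subgroupX => //; exact: HV.
have [_ f'q] := pl_supp_fix Hf'.
have tq' : f' t < q by rewrite -f'q oaut_ltE.
pose m := Num.max y1 (f' t).
have mq : m < q by rewrite gt_max yq.
have ym : y1 <= m by rewrite le_max lexx.
have tm : f' t <= m by rewrite le_max lexx orbT.
have [|e Ae /andP[em eq]] := submodule_dense (y1 := m - y1) (y2 := q - y1) PG AM Pa a1 k0.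
  by lra.
have e0 : 0 < e by rewrite -(pmulr_rgt0 _ k0); lra.
have [||g [Hg gs gdown]] := bump_in Ay Ae e0; [lra|lra|].
set r := y1 + k * e in gs gdown.
have [gy gr] : g y1 = y1 /\ g r = r by rewrite !gs//; [right|left].
have gup x : y1 < x < r -> x < (g^-1)%g x.
  by move=> xr; rewrite -oaut_ltV gdown.
have yr : y1 < r by rewrite /r; lra.
(* A target in (y1, r) and below [y2]. *)
pose y3 := (y1 + Num.min y2 r) / 2.
have ymin : y1 < Num.min y2 r by rewrite lt_min y12.
have minle : Num.min y2 r <= y2 by rewrite ge_min lexx.
have [|||j jt] := @oaut_climb _ (g^-1)%g y1 r y3 (f' t) _ gup.
- exact: oaut_fixV.
- by rewrite /y3; lra.
- by rewrite /r; lra.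
have Hgj : pl_supp (g ^+ j)%g by exact: subgroupX.
exists (g ^+ j * f')%g; split; first exact: HM.
- by rewrite oautME -[ltLHS](oaut_fixX j gy) oaut_ltE.
- rewrite oautME oaut_ltV -expVgn; apply: lt_trans jt _.
  by rewrite oaut_ltE /y3; lra.
Qed.

(** Take two overlapping bumps [c1] and [c2], [c1] on the left. The right end of the
    support of [c1] is moved by [c2] into the interior of that support; if they
    commuted, [c1] would fix the image. *)
Lemma noncommuting_pair : exists s t c1 c2, [/\ p < s, t < q,
  pl_supp c1 /\ supp_in s t c1, pl_supp c2 /\ supp_in s t c2 & [~ c1, c2]%g <> 1%g].
Proof.
have [a1' b1' k0' pq'] := And4 a1 b1 k0 pq.
have dense y1 y2 : y1 < y2 -> exists2 e, A e & y1 < k * e < y2.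
  exact: submodule_dense PG AM Pa a1 k0.
have dense1 y1 y2 : y1 < y2 -> exists2 e, A e & y1 < e < y2.
  move=> y12; have [e] := submodule_dense PG AM Pa a1 ltr01 y12.
  by rewrite mul1r; exists e.
have [l1 Al1 /andP[pl1 l1q]] := dense1 _ _ pq.
have [|e1 Ae1 /andP[e1l e1r]] := dense 0 (q - l1); first lra.
pose r1 := l1 + k * e1.
have [|l2 Al2 /andP[l12 l2r]] := dense1 l1 r1; first by rewrite /r1; lra.
have [|e2 Ae2 /andP[e2l e2r]] := dense (r1 - l2) (q - l2); first by rewrite /r1; lra.
pose r2 := l2 + k * e2.
have e10 : 0 < e1 by rewrite -(pmulr_rgt0 _ k0).
have e20 : 0 < e2 by rewrite -(pmulr_rgt0 _ k0); lra.
have r1q : r1 < q by rewrite /r1; lra.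
have r2q : r2 < q by rewrite /r2; lra.
have r12 : r1 < r2 by rewrite /r2; lra.
have [||c1 [Hc1 s1 d1]] := bump_in Al1 Ae1 e10; [lra|lra|].
have [||c2 [Hc2 s2 d2]] := bump_in Al2 Ae2 e20; [lra|lra|].
rewrite -/r1 in s1 d1; rewrite -/r2 in s2 d2.
exists l1, r2, c1, c2; split => //.
- by split=> //; apply: supp_inS s1; lra.
- by split=> //; apply: supp_inS s2; lra.
move=> /eqP/commgP cc.
have c1r : c1 r1 = r1 by apply: s1; right.
have c2r : c2 r1 < r1 by apply: d2; rewrite l2r.
have c2l : l1 < c2 r1.
  by apply: lt_trans l12 _; rewrite -[ltLHS]s2 ?oaut_ltE//; left.
have : c1 (c2 r1) < c2 r1 by apply: d1; rewrite c2l.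
by rewrite -oautME cc oautME c1r ltxx.
Qed.

(** A nontrivial [z] moves some interval off itself. If [u] and [v] are supported in
    that interval, then [u^-1 ^ z] commutes with [v], so the commutator of
    [[~ u^-1, z]], which is [u * u^-1 ^ z], with [v] is conjugate to [[~ u, v]].
    Any [c1] and [c2] as below can be conjugated into such an interval. *)
Lemma commutator_in_normal N s t c1 c2 : p < s -> t < q ->
  pl_supp c1 -> supp_in s t c1 -> pl_supp c2 -> supp_in s t c2 ->
  normal_subgroup N pl_supp -> (exists2 z, N z & z <> 1%g) -> N [~ c1, c2]%g.
Proof.
move=> ps tq Hc1 s1 Hc2 s2 [NG NH NJ] [z0 Nz0 z0n1].
have [_ NM NV] := NG; have [_ HM HV] := HG.
have [z [y Nz zy]] : exists z, exists2 y, N z & y < z y.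
  have [y zy] : exists y, z0 y <> y.
    apply: contrapT => /forallNP nz; apply: z0n1; apply: oaut_ext => y.
    by apply: contrapT; exact: nz.
  have [yz|zy'|yE] := ltgtP y (z0 y); first by exists z0, y.
    by exists (z0^-1)%g, y; [exact: NV | rewrite -oaut_ltV].
  by rewrite -yE in zy.
have Hz := NH _ Nz; have [zp zq] := pl_supp_fix Hz.
have [py yq] : p < y /\ y < q.
  by split; rewrite ltNge; apply/negP => H; move: zy;
    rewrite (Hz.2 y) ?ltxx//; [left|right].
have zyq : z y < q by rewrite -zq oaut_ltE.
have [y1] := submodule_dense PG AM Pa a1 ltr01 zy; rewrite mul1r => Ay1 /andP[yy1 y1z].
have [|h [Hh hs ht]] := squeeze Ay1 _ y1z ps tq; first by rewrite (lt_trans py)//=; lra.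
have HhV := HV _ Hh.
pose u := (c1 ^ h^-1)%g; pose v := (c2 ^ h^-1)%g.
have supp_h x' : supp_in s t x' -> supp_in y1 (z y) (x' ^ h^-1)%g.
  move=> /(supp_inJ (h^-1)%g); rewrite invgK; apply: supp_inS; exact: ltW.
have su : supp_in y1 (z y) u by exact: supp_h.
have sv : supp_in y1 (z y) v by exact: supp_h.
have Hu : pl_supp u by exact: subgroupJ.
have Hv : pl_supp v by exact: subgroupJ.
pose w := ((u^-1) ^ z)%g.
have Hw : pl_supp w by apply: subgroupJ => //; exact: HV.
have vw : commute w v.
  apply: (@disjoint_commute _ y1) => x xy; last by apply: sv; left.
  have sw := supp_inJ z (supp_inV su); apply: sw; right.
  by rewrite oautK; lra.
have Nuz : N [~ u^-1, z]%g.
  have -> : [~ u^-1, z]%g = ((z^-1) ^ (u^-1) * z)%g by rewrite commgEr.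
  by apply: NM => //; apply: NJ; [exact: HV | exact: NV].
have Nuzv : N [~ [~ u^-1, z], v]%g.
  by rewrite commgEl; apply: (NM); [exact: NV | exact: NJ].
have E : [~ [~ u^-1, z], v]%g = ([~ u, v] ^ w)%g.
  have -> : [~ u^-1, z]%g = (u * w)%g by rewrite commgEl invgK.
  exact: commgMl_commute.
have : N ([~ u, v] ^ h)%g.
  apply: (NJ) => //; rewrite -[[~ u, v]%g](conjgK w) -E.
  by apply: (NJ) => //; exact: HV.
by rewrite conjRg /u /v !conjgKV.
Qed.

(** ** Fixed points of words in two bumps *)

Lemma inner_side_stable f x d : pl_supp f -> inner_side d x -> inner_side d (f x).
Proof.
move=> /pl_supp_fix[fp fq]; rewrite /inner_side.
case: d => /andP[px xq]; apply/andP; split.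
- by rewrite -[ltLHS]fp oaut_ltE.
- by rewrite -[leRHS]fq oaut_leE.
- by rewrite -[leLHS]fp oaut_leE.
- by rewrite -[ltRHS]fq oaut_ltE.
Qed.

Lemma power_slope f s t m x d : pl_supp f -> 0 < s -> 0 < t ->
  (forall x d, inner_side d x -> germ d f x s^-1 \/ germ d f x t) ->
  inner_side d x ->
  exists2 i, (i <= m)%N & germ d (f ^+ m)%g x (s ^- i * t ^+ (m - i)).
Proof.
move=> Hf s0 t0 fst xd; elim: m => [|m [i im IH]].
  by exists 0%N => //; rewrite expr0 invr1 mul1r; exact: germ_id.
have gt0 : 0 < s ^- i * t ^+ (m - i) by rewrite mulr_gt0 ?invr_gt0 ?exprn_gt0.
have Hfm : pl_supp (f ^+ m)%g by exact: subgroupX.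
have [fs|ft] := fst _ _ (inner_side_stable Hfm xd); rewrite expgS.
- exists i.+1 => //; rewrite subSS exprS invfM -mulrA.
  exact: germ_comp gt0 IH fs.
- exists i; first exact: leqW.
  rewrite subSn// exprS mulrCA; exact: germ_comp gt0 IH ft.
Qed.

Hypothesis ab_indep : multiplicatively_independent a b.
Variables (f g : oaut R).
Hypotheses (Hf : pl_supp f) (Hg : pl_supp g).
Hypothesis fdown : forall x, p < x < q -> f x < x.
Hypothesis gdown : forall x, p < x < q -> g x < x.
Hypothesis fslope : forall x d, inner_side d x -> germ d f x a^-1 \/ germ d f x b.
Hypothesis gslope : forall x d, inner_side d x -> germ d g x b^-1 \/ germ d g x a.

Lemma powers_down h m x : (forall x, p < x < q -> h x < x) -> pl_supp h ->
  p < x < q -> (h ^+ m)%g x <= x ?= iff (m == 0)%N.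
Proof.
move=> hdown Hh xpq; apply/leifP.
elim: m => [|m IH] /=; first by [].
apply: (@lt_le_trans _ _ ((h ^+ m)%g x)).
  rewrite expgS oautME; apply: hdown; apply: pl_supp_stable => //.
  exact: subgroupX.
by case: eqP IH => [_ /eqP ->//|_ /ltW].
Qed.

(** The slopes of [f ^+ m] are [a ^- i * b ^+ (m - i)] and those of [g ^+ n] are
    [b ^- j * a ^+ (n - j)]. If two of them were equal, then
    [a ^+ (n - j + i) = b ^+ (m - i + j)], hence [m = n = 0] by independence. So
    [f ^+ m] and [g ^+ n] do not agree on an interval, which settles
    [f ^+ m * g ^- n]; the word [f ^+ m * g ^+ n] moves all of (p, q) to the left. *)
Lemma word_germ_neq1 m n w d x : (0 < m + n)%N ->
  w = (f ^+ m * g ^+ n)%g \/ w = (f ^+ m * g ^- n)%g ->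
  inner_side d x -> w x = x -> ~ germ d w x 1.
Proof.
move=> mn wE xd wx gw.
have [a1' b1' pq'] := And3 a1 b1 pq.
have a0 : 0 < a by lra.
have b0 : 0 < b by lra.
case: wE => wE.
- have [e e0 we] := gw.
  have [r1 r10 r1q] : exists2 r1 : R, 0 < r1 &
      forall r, 0 < r <= r1 -> p < x + (-1) ^+ d * r < q.
    exists (if d then (x - p) / 2 else (q - x) / 2).
      by case: d xd {gw we} => /=; lra.
    by move=> r; case: d xd {gw we} => /= xd; rewrite ?expr1 ?expr0; lra.
  pose r := Num.min e r1; have r0 : 0 < r by rewrite lt_min e0.
  pose y := x + (-1) ^+ d * r.
  have ypq : p < y < q by apply: r1q; rewrite r0 ge_min lexx orbT.
  have : w y = y by rewrite /y we ?wx ?mul1r// (ltW r0) /r ge_min lexx.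
  have Hgn : pl_supp (g ^+ n)%g by exact: subgroupX.
  have gypq := pl_supp_stable Hgn ypq.
  have := leif_trans (powers_down m fdown Hf gypq) (powers_down n gdown Hg ypq).
  rewrite -oautME -wE => -[_ +] wy; rewrite wy eqxx => /esym/andP[/eqP m0 /eqP n0].
  by rewrite m0 n0 in mn.
- pose x' := (g ^- n)%g x.
  have gx' : (g ^+ n)%g x' = x by rewrite oautVK.
  have Hgn : pl_supp (g ^- n)%g.
    by have [_ _ HV] := HG; apply: HV; exact: subgroupX.
  have xd' : inner_side d x' by exact: inner_side_stable.
  have [i im fi] := power_slope m Hf a0 b0 fslope xd'.
  have [j jn gj] := power_slope n Hg b0 a0 gslope xd'.
  have gj0 : 0 < b ^- j * a ^+ (n - j) by rewrite mulr_gt0 ?invr_gt0 ?exprn_gt0.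
  have gV := germ_inv gj0 gj; rewrite gx' in gV.
  have w1 : germ d w x ((a ^- i * b ^+ (m - i)) * (b ^- j * a ^+ (n - j))^-1).
    by rewrite wE; apply: germ_comp => //; rewrite invr_gt0.
  have E : a ^- i * b ^+ (m - i) = b ^- j * a ^+ (n - j).
    by rewrite -[LHS](mulfVK (lt0r_neq0 gj0)) -(germ_uniq gw w1) mul1r.
  have ai : a ^+ i != 0 by rewrite expf_neq0// gt_eqF.
  have bj : b ^+ j != 0 by rewrite expf_neq0// gt_eqF.
  have : a ^+ (n - j + i) = b ^+ (m - i + j).
    rewrite !exprD; apply: (mulfI (invr_neq0 ai)); apply: (mulIf (invr_neq0 bj)).
    by rewrite mulrCA mulVf// mulr1 mulrA mulfK// mulrC E.
  move=> /ab_indep[]; move: mn im jn; clear; lia.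
Qed.

Lemma word_fix_finite m n w : (0 < m + n)%N ->
  w = (f ^+ m * g ^+ n)%g \/ w = (f ^+ m * g ^- n)%g ->
  finite_set [set x | p <= x <= q /\ w x = x].
Proof.
move=> mn wE.
have plw : pl A P w.
  have [_ HM HV] := HG.
  have Hfm : pl_supp (f ^+ m)%g by exact: subgroupX.
  have Hgn : pl_supp (g ^+ n)%g by exact: subgroupX.
  by case: wE => ->; [have [] := HM _ _ Hfm Hgn | have [] := HM _ _ Hfm (HV _ Hgn)].
apply: (@discrete_segment_finite _ _ p q) => [x []//|z d zpq].
have [zd|zd] := boolP (inner_side d z).
  have [_ wgerm _] := plw; have [s _ ws] := wgerm z d.
  have [|e e0 He] := germ_isolated ws.
    by move=> wz s1; rewrite s1 in ws; exact: (word_germ_neq1 mn wE zd wz).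
  by exists e => // h /He wh [].
exists 1 => // h /andP[h0 _] [+ _]; apply/negP; move: zd; rewrite /inner_side.
by case: d; rewrite ?expr1 ?expr0; lra.
Qed.

End PLElements.

(** The word [w] has finitely many fixed points, but if [h] conjugates each
    [b0 ^ (f ^+ i)] to an element commuting with [w], then [w] fixes the images by
    [h^-1 f ^- i] of the last point of the support of [b0]. *)
Theorem pl_supp_no_dyadic_action (R : realType) (A P : set R) (a b p c : R)
    (Phi : oaut R -> oaut R) (lo hi : R) :
  positive_subgroup P -> nonzero_submodule P A -> P a -> P b -> 1 < a -> 1 < b ->
  multiplicatively_independent a b -> A p -> A c -> 0 < c ->
  let H := pl_supp A P a b p c in
  (forall f g, H f -> H g -> Phi (f * g)%g = (Phi f * Phi g)%g) ->
  (forall f x, H f -> ~~ (lo <= x <= hi) -> Phi f x = x) ->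
  (forall f, H f -> dyadic_germs (Phi f)) ->
  (forall f, H f -> Phi f = 1%g -> f = 1%g) -> False.
Proof.
move=> PG AM Pa Pb a1 b1 ab Ap Ac c0 H PhiM Phi_supp Phi_dyadic Phi_inj.
have HG : subgroup H by exact: pl_supp_group.
have [_ HM HV] := HG.
pose q := p + (a * b - 1) * c.
have [f [Hf fdown fslope]] :=
  bump_full PG AM Pa Pb a1 b1 Ap Ac c0 (or_introl (conj erefl erefl)).
have [g [Hg gdown gslope]] :=
  bump_full PG AM Pa Pb a1 b1 Ap Ac c0 (or_intror (conj erefl erefl)).
have [s [t [c1 [c2 [ps tq [Hc1 s1] [Hc2 s2] c12]]]]] :=
  noncommuting_pair p PG AM Pa Pb a1 b1 c0.
rewrite -/q in tq.
pose b0 := [~ c1, c2]%g.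
have Hb0 : H b0 by exact: subgroupR.
have sb0 : supp_in s t b0.
  have sJ x y : supp_in s t x -> supp_in s t y -> supp_in s t (x ^ y)%g.
    by move=> sx sy; rewrite conjgE; apply: supp_inM (supp_inV sy) (supp_inM sx sy).
  by rewrite /b0 commgEl; apply: supp_inM (supp_inV s1) (sJ _ _ s1 s2).
have [m [n [w [mn wE wD]]]] : exists m n w, [/\ (0 < m + n)%N,
    w = (f ^+ m * g ^+ n)%g \/ w = (f ^+ m * g ^- n)%g &
    forall D : seq (oaut R),
    (forall b, b \in D -> exists x y, [/\ H x, H y & b = [~ x, y]%g]) ->
    exists2 h, H h & forall b, b \in D -> commute w (b ^ h)%g].
  apply: (commutators_displaced HG PhiM Phi_supp Phi_dyadic Hb0 _ _ Hf Hg).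
    by move=> /(Phi_inj _ Hb0).
  move=> N NN Nz.
  exact: (commutator_in_normal PG AM Pa Pb a1 b1 Ap Ac c0 ps tq Hc1 s1 Hc2 s2 NN Nz).
have finF := word_fix_finite PG a1 b1 c0 ab Hf Hg fdown gdown fslope gslope mn wE.
have [F FE] := (finite_seqP _).1 finF.
pose S := [set x | b0 x <> x].
have Sst x : S x -> s <= x <= t.
  move=> bx; apply/andP; split; rewrite leNgt; apply/negP => lt; apply: bx; apply: sb0.
    by left; exact: ltW.
  by right; exact: ltW.
have [x Sx] : S !=set0.
  apply/set0P/negP => /eqP S0; apply: c12; apply: oaut_ext => x.
  apply: contrapT => bx; have : S x by [].
  by rewrite S0.
have supS : has_sup S by split; [exists x | exists t => y /Sst/andP[]].
pose e := sup S.
have pe : p < e.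
  have /andP[sx _] := Sst x Sx.
  by apply: lt_le_trans ps (le_trans sx _); apply: ub_le_sup => //; case: supS.
have eq : e < q.
  by apply: le_lt_trans tq; apply: ge_sup => [|y /Sst/andP[]//]; exists x.
have [|h Hh hD] := wD [seq (b0 ^ (f ^+ i))%g | i <- iota 0 (size F).+1].
  move=> _ /mapP[i _ ->]; rewrite /b0 conjRg.
  by eexists; eexists; split; [| |reflexivity]; apply: subgroupJ => //; exact: subgroupX.
pose y i := ((f ^+ i * h)^-1)%g e.
have Hk i : H ((f ^+ i * h)^-1)%g by apply: HV; apply: HM => //; exact: subgroupX.
have yF i : (i < (size F).+1)%N -> y i \in F.
  move=> iF; have : [set x | p <= x <= q /\ w x = x] (y i).
    split.
      have /andP[py yq] : p < y i < q by apply: (pl_supp_stable (Hk i)); rewrite pe.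
      by rewrite !ltW.
    have : commute w ((b0 ^ (f ^+ i)) ^ h)%g.
      by apply: hD; apply/mapP; exists i => //; rewrite mem_iota.
    rewrite -conjgM; set u := (f ^+ i * h)%g => wb.
    have : commute b0 (w ^ u^-1)%g.
      have -> : b0 = ((b0 ^ u) ^ u^-1)%g by rewrite conjgK.
      by rewrite /commute -!conjMg wb.
    move=> /commute_sym/commute_fix_sup/(_ supS).
    by rewrite conjgE invgK !oautME -/S -/e => wue; rewrite /y -/u -[in RHS]wue oautK.
  by rewrite FE.
have y_lt i j : (i < j)%N -> y i < y j.
  move=> ij; rewrite /y !invgM !oautME oaut_ltE.
  rewrite -(subnK (ltnW ij)) expgnDr invgM oautME oaut_ltE -oaut_ltV.
  have epq : p < e < q by rewrite pe.
  have := powers_down PG (j - i) fdown Hf epq.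
  by rewrite subn_eq0 leqNgt ij => /leifP.
have y_inj : injective y.
  by move=> i j yij; case: (ltngtP i j) => // /y_lt; rewrite yij ltxx.
have /uniq_leq_size : uniq [seq y i | i <- iota 0 (size F).+1].
  by rewrite map_inj_uniq ?iota_uniq.
move=> /(_ F); rewrite size_map size_iota ltnn => H0; apply: notF; apply: H0.
by move=> _ /mapP[i iF ->]; apply: yF; rewrite mem_iota in iF.
Qed.

(** * Homeomorphisms of subsets of the line *)

Section Slopes.
Variable R : realType.
Implicit Types (f : R -> R) (o : oaut R) (x s t : R).

Lemma near_realP (Q : R -> Prop) x :
  (\forall y \near x, Q y) <-> exists2 e : R, 0 < e & forall y, `|x - y| < e -> Q y.
Proof.
split=> [/nbhs_ballP[e e0 He]|[e e0 He]]; first by exists e => // y xy; apply: He.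
by apply/nbhs_ballP; exists e => // y; exact: He.
Qed.

Lemma oaut_continuous o : continuous o.
Proof.
move=> x; apply/cvgrPdist_lt => e e0.
pose l := (o^-1)%g (o x - e); pose r := (o^-1)%g (o x + e).
have lx : l < x by rewrite /l -oaut_gtV; lra.
have xr : x < r by rewrite /r -oaut_ltV; lra.
apply/near_realP; exists (Num.min (x - l) (r - x)).
  by rewrite lt_min !subr_gt0 lx.
move=> y; rewrite lt_min !ltr_norml => /andP[/andP[y1 y2] /andP[y3 y4]].
have : o l < o y by rewrite oaut_ltE; lra.
have : o y < o r by rewrite oaut_ltE; lra.
by rewrite /l /r !oautVK => ? ?; lra.
Qed.

Lemma germ_of_slope d f x s : has_slope f x s -> germ d f x s.
Proof.
move=> [t /near_realP[e e0 He]]; exists (e / 2); first by rewrite divr_gt0.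
move=> h /andP[h0 he]; rewrite !He ?subrr ?normr0//; first by ring.
by rewrite opprD addNKr normrN normrM normr_sign mul1r ger0_norm//; lra.
Qed.

Lemma slope_of_germs f x s : (forall d, germ d f x s) -> has_slope f x s.
Proof.
move=> H; have [e e0 He] := H false; have [e' e'0 He'] := H true.
exists (f x - s * x); apply/near_realP; exists (Num.min e e').
  by rewrite lt_min e0.
move=> y; rewrite lt_min !ltr_norml => /andP[/andP[y1 y2] /andP[y3 y4]].
have [xy|/ltW yx] := leP x y.
  have := He (y - x); rewrite expr0 !mul1r [x + (y - x)]addrC subrK => ->; [ring|lra].
have := He' (x - y); rewrite expr1 !mulN1r opprB [x + (y - x)]addrC subrK => ->; [ring|lra].
Qed.

Lemma slope_near_germ d f x s : germ d f x s -> exists2 e : R, 0 < e &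
  forall h : R, 0 < h <= e -> has_slope f (x + (-1) ^+ d * h) s.
Proof.
move=> [e e0 He]; exists (e / 2); first by rewrite divr_gt0.
move=> h /andP[h0 he]; exists (f x - s * x); apply/near_realP.
exists (Num.min h (e / 2)); first by rewrite lt_min h0 divr_gt0.
move=> y; rewrite lt_min !ltr_norml => /andP[/andP[y1 y2] /andP[y3 y4]].
have := He ((-1) ^+ d * (y - x)); rewrite signrMK [x + (y - x)]addrC subrK => ->.
  by rewrite [s * (_ * _)]mulrCA signrMK; ring.
by case: d {He} y1 y2 y3 y4; rewrite ?expr1 ?expr0; lra.
Qed.

Lemma near_affine_uniq f x s t s' t' :
  (\forall y \near x, f y = s * y + t) -> (\forall y \near x, f y = s' * y + t') ->
  s = s' /\ t = t'.
Proof.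
move=> /near_realP[e e0 He] /near_realP[e' e'0 He'].
pose r := Num.min e e' / 2.
have r0 : 0 < r by rewrite divr_gt0// lt_min e0.
have re : r < e.
  by have : Num.min e e' <= e; [rewrite ge_min lexx | rewrite /r in r0 *; lra].
have re' : r < e'.
  by have : Num.min e e' <= e'; [rewrite ge_min lexx orbT | rewrite /r in r0 *; lra].
have xr : `|x - (x + r)| = r by rewrite opprD addNKr normrN gtr0_norm.
have E1 : s * x + t = s' * x + t' by rewrite -He ?He'// subrr normr0.
have E2 : s * (x + r) + t = s' * (x + r) + t' by rewrite -He ?He'// xr.
have : (s - s') * r = 0 by rewrite !mulrDr in E2; lra.
move/eqP; rewrite mulf_eq0 subr_eq0 (gt_eqF r0) orbF => /eqP ss.
by move: E1; rewrite ss => /addrI.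
Qed.

(** Affine maps that agree near a point are equal. So the set of points near which the
    function is one given affine map is open and closed in the interval, which is
    connected. *)
Lemma locally_affine_interval (Q : R -> Prop) f (e : R) : 0 < e ->
  (forall h, 0 < h < e -> exists s t, Q s /\ \forall y \near h, f y = s * y + t) ->
  exists s t, Q s /\ forall h, 0 < h < e -> f h = s * h + t.
Proof.
move=> e0 loc; have [|s [t [Qs st]]] := loc (e / 2); first lra.
exists s, t; split => //.
pose B := [set h | 0 < h < e /\ \forall y \near h, f y = s * y + t].
suff BE : B = `]0, e[%classic.
  move=> h h0e; have : `]0, e[%classic h by rewrite /= in_itv.
  by rewrite -BE => -[_ /nbhs_singleton].
have /connected_intervalP := @interval_is_interval R `]0, e[; apply.
- by exists (e / 2); split => //; lra.
- exists [set y | f y = s * y + t]°; first exact: open_interior.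
  by apply/seteqP; split=> h; rewrite /B /= in_itv.
- exists (~` (\bigcup_(u in [set u : R * R | u <> (s, t)])
              [set y | f y = u.1 * y + u.2]°)).
    by apply: open_closedC; apply: bigcup_open => u _; exact: open_interior.
  apply/seteqP; split=> h; rewrite /B /= in_itv/= => -[h0e].
    move=> hst; split => // -[[s' t'] /= ne] hst'; apply: ne.
    by have [-> ->] := near_affine_uniq hst' hst.
  move=> nh; split => //; have [s' [t' [_ hst']]] := loc h h0e.
  have [[<- <-]//|ne] := pselect ((s', t') = (s, t)).
  by case: nh; exists (s', t').
Qed.

Lemma finite_set_avoid d x (B : set R) : finite_set B -> exists2 e : R, 0 < e &
  forall h : R, 0 < h < e -> ~ B (x + (-1) ^+ d * h).
Proof.
move=> /finite_seqP[s ->] {B}; elim: s => [|b s [e e0 He]]; first by exists 1.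
have [xb|xb] := eqVneq x b.
  exists e => // h /andP[h0 he]; rewrite /= inE => /orP[/eqP|]; last first.
    by apply: He; rewrite h0.
  rewrite xb => /(congr1 (fun y => y - b)) /eqP.
  by rewrite addrAC subrr add0r mulf_eq0 signr_eq0 (gt_eqF h0).
exists (Num.min e `|b - x|).
  by rewrite lt_min e0 normr_gt0 subr_eq0 eq_sym.
move=> h; rewrite lt_min => /and3P[h0 he hb]; rewrite /= inE => /orP[/eqP bE|]; last first.
  by apply: He; rewrite h0.
by move: hb; rewrite -bE addrAC subrr add0r normrM normr_sign mul1r gtr0_norm ?ltxx.
Qed.
End Slopes.

(** ** Piecewise linear maps supported in a segment *)

Section PLHomeo.
Variable R : realType.
Variables (A P J : set R) (o : oaut R) (p q : R).
Hypotheses (plo : pl A P o) (so : supp_in p q o) (pqJ : `[p, q] `<=` J).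

Lemma supp_in_stable f x : supp_in p q f -> J x -> J (f x).
Proof.
move=> sf Jx; have [xp|px] := leP x p; first by rewrite sf//; left.
have [qx|xq] := leP q x; first by rewrite sf//; right.
have fp : f p = p by rewrite sf//; left.
have fq : f q = q by rewrite sf//; right.
apply: pqJ; rewrite /= in_itv /=.
by rewrite -[leLHS]fp -[in X in _ && X]fq !oaut_leE !ltW.
Qed.

Lemma unbroken_near (d : bool) x : exists2 e : R, 0 < e &
  forall h : R, 0 < h <= e -> exists s, has_slope o (x + (-1) ^+ d * h) s.
Proof.
have [_ /(_ x d)[s _ /slope_near_germ[e e0 He]] _] := plo.
by exists e => // h /He; exists s.
Qed.

Lemma pl_homeo_supp : (forall x, ~ J x -> x <= p \/ q <= x) -> pl_homeo J o.
Proof.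
move=> nJ; split.
- split=> [x /nJ/so//|]; exists (o^-1)%g; split.
  + by split=> x; apply: supp_in_stable => //; exact: supp_inV.
  + by split=> x _; rewrite ?oautK ?oautVK.
  + by apply: continuous_subspaceT; exact: oaut_continuous.
  + by apply: continuous_subspaceT; exact: oaut_continuous.
- by move=> x y _ _; exact: oaut_lt.
- apply: (@discrete_segment_finite _ _ p q).
    move=> x [_ nx]; apply: contrapT => xpq; apply: nx.
    exists 1, 0; move: xpq => /negP; rewrite negb_and -!ltNge => xpq.
    pose e := if x < p then p - x else x - q.
    apply/near_realP; exists e.
      by rewrite /e; case: ifP xpq => [|_ /=]; rewrite subr_gt0.
    move=> y; rewrite mul1r addr0 ltr_norml /e => xy; apply: so.
    by case: ifP xpq xy => [? _|_ /= ?] ?; [left | right]; lra.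
  move=> z d _; have [e e0 He] := unbroken_near d z.
  by exists e => // h /He ? [].
Qed.

Lemma pl_slopes : slopes J o `<=` P.
Proof.
by move=> s [x _] /(germ_of_slope false)/(pl_germ_slope plo).
Qed.

Lemma pl_breakpoints : breakpoints J o `<=` A.
Proof.
move=> x [_ nx]; apply: contrapT => nAx; apply: nx.
by have [_ _ /(_ x nAx)[s /slope_of_germs]] := plo; exists s.
Qed.

Lemma pl_image : o @` A = A.
Proof.
have [oA _ _] := plo; apply/seteqP; split=> [_ [x /oA ? <-]//|x Ax].
by exists ((o^-1)%g x); [apply/oA|]; rewrite oautVK.
Qed.

End PLHomeo.

(** * Germs of elements of Thompson's group *)

Section Thompson.
Variable R : realType.

Lemma itv01P (x : R) : `[0, 1]%classic x = (0 <= x <= 1).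
Proof. by rewrite /= in_itv. Qed.

Lemma homeomorphism_oaut (f : R -> R) :
  homeomorphism `[0, 1] f -> orientation_preserving `[0, 1] f ->
  exists o : oaut R, (o : R -> R) = f.
Proof.
move=> [fid [g [[fJ gJ] [fK gK] _ _]]] fm.
have {}fJ x : 0 <= x <= 1 -> 0 <= f x <= 1.
  by move=> x01; have := fJ x; rewrite !itv01P; exact.
have {}gJ x : 0 <= x <= 1 -> 0 <= g x <= 1.
  by move=> x01; have := gJ x; rewrite !itv01P; exact.
have {}fid x : ~~ (0 <= x <= 1) -> f x = x.
  by move=> /negP x01; apply: fid; rewrite itv01P.
have {}fK x : 0 <= x <= 1 -> g (f x) = x by move=> x01; apply: fK; rewrite itv01P.
have {}gK x : 0 <= x <= 1 -> f (g x) = x by move=> x01; apply: gK; rewrite itv01P.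
pose g' x := if 0 <= x <= 1 then g x else x.
have fg' : cancel f g'.
  move=> x; rewrite /g'; have [x01|x01] := boolP (0 <= x <= 1); first by rewrite fJ// fK.
  by rewrite fid// (negbTE x01).
have g'f : cancel g' f.
  by move=> x; rewrite /g'; case: ifPn => x01; [exact: gK | exact: fid].
have mono : {homo f : x y / x < y}.
  move=> x y xy.
  have [x01|x01] := boolP (0 <= x <= 1); have [y01|y01] := boolP (0 <= y <= 1).
  - by apply: fm => //; rewrite itv01P.
  - by have := fJ x x01; rewrite (fid y)//; move: y01; rewrite negb_and -!ltNge; lra.
  - by have := fJ y y01; rewrite (fid x)//; move: x01; rewrite negb_and -!ltNge; lra.
  - by rewrite !fid.
by exists (Oaut fg' g'f mono).
Qed.

(** As there are finitely many breakpoints, some interval on the given side of [x]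
    contains none; the map is locally affine on it, hence affine, and continuity at
    [x] gives the constant term. *)
Lemma thompsonF_oaut (f : R -> R) : thompsonF R f -> exists o : oaut R,
  [/\ (o : R -> R) = f, forall x, ~~ (0 <= x <= 1) -> o x = x & dyadic_germs o].
Proof.
move=> [[fh fm fin] _ fslopes]; have [ o oE] := homeomorphism_oaut fh fm.
have oid x : ~~ (0 <= x <= 1) -> o x = x.
  by move=> x01; rewrite oE; case: fh => + _; apply; rewrite itv01P; exact/negP.
exists o; split => // x d.
have o_end : supp_in 0 1 o.
  have o0 : o 0 = 0.
    have oneg (y : R) : y < 0 -> o y = y by move=> y0; apply: oid; rewrite negb_and -!ltNge y0.
    have [ o0|o0|//] := ltgtP (o 0) 0; first by apply: (@oautI _ o); rewrite oneg.
    have y0 : (o^-1)%g 0 < 0 by rewrite -oaut_gtV.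
    by have := oneg _ y0; rewrite oautVK => E; rewrite -E ltxx in y0.
  have o1 : o 1 = 1.
    have obig y : 1 < y -> o y = y.
      by move=> y1; apply: oid; rewrite negb_and -!ltNge y1 orbT.
    have [ o1|o1|//] := ltgtP (o 1) 1; last by apply: (@oautI _ o); rewrite obig.
    have y1 : 1 < (o^-1)%g 1 by rewrite -oaut_ltV.
    by have := obig _ y1; rewrite oautVK => E; rewrite -E ltxx in y1.
  move=> y [] ; rewrite le_eqVlt => /predU1P[].
  - by move=> ->.
  - by move=> y0; apply: oid; rewrite negb_and -!ltNge y0.
  - by move=> <-.
  - by move=> y1; apply: oid; rewrite negb_and -!ltNge y1 orbT.
pose inside h := 0 < x + (-1) ^+ d * h < 1.
have [[r r0 rin]|[r r0 rout]] :
    (exists2 r : R, 0 < r & forall h : R, 0 < h < r -> inside h) \/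
    (exists2 r : R, 0 < r & forall h : R, 0 <= h <= r ->
      o (x + (-1) ^+ d * h) = x + (-1) ^+ d * h).
  rewrite /inside; case: d {inside} => /=.
    have [x0|x0] := leP x 0.
      by right; exists 1 => // h; rewrite expr1 => ?; apply: o_end; left; lra.
    have [x1|x1] := leP x 1.
      by left; exists x => // h; rewrite expr1; lra.
    by right; exists (x - 1); [lra | move=> h; rewrite expr1 => ?; apply: o_end; right; lra].
  have [x0|x0] := ltP x 0.
    by right; exists (- x); [lra | move=> h; rewrite expr0 => ?; apply: o_end; left; lra].
  have [x1|x1] := ltP x 1.
    by left; exists (1 - x); [lra | move=> h; rewrite expr0; lra].
  by right; exists 1 => // h; rewrite expr0 => ?; apply: o_end; right; lra.
- have [e e0 He] := finite_set_avoid d x fin.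
  pose F h := o (x + (-1) ^+ d * h).
  pose Q s := exists k : int, s = (-1) ^+ d * 2 ^ k :> R.
  have m0 : 0 < Num.min e r by rewrite lt_min e0.
  have [|s [t [[k ->] FE]]] := @locally_affine_interval _ Q F _ m0.
    move=> h; rewrite lt_min => /and3P[h0 he hr].
    have hin := rin h; rewrite /inside h0 hr in hin.
    have xin : interior (`[0, 1]%classic : set R) (x + (-1) ^+ d * h).
      by rewrite interior_itv_bnd /= in_itv /= hin.
    have [a ha] : exists a, has_slope f (x + (-1) ^+ d * h) a.
      by apply: contrapT => nb; apply: (He h); rewrite ?h0.
    have [k ak] : exists k : int, a = 2 ^ k by apply: fslopes; exists (x + (-1) ^+ d * h).
    case: ha => b /near_realP[u u0 Hu].
    exists ((-1) ^+ d * 2 ^ k), (2 ^ k * x + b); split; first by exists k.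
    apply/near_realP; exists u => // y hy; rewrite /F oE Hu; last first.
      by rewrite opprD addrACA subrr add0r -mulrBr normrM normr_sign mul1r.
    by rewrite ak; ring.
  exists k; exists (Num.min e r / 2); first by rewrite divr_gt0.
  have tE : t = o x.
    apply/eqP; rewrite eq_sym -subr_eq0; apply/eqP; apply: contrapT => /eqP ne.
    have /cvgrPdist_lt/(_ (`|o x - t| / 2)) := @oaut_continuous _ o x.
    rewrite divr_gt0 ?normr_gt0// => /(_ isT)/near_realP[u u0 Hu].
    set z := `|o x - t| in Hu.
    have z0 : 0 < z by rewrite normr_gt0.
    have k0 := exp2z_gt0 R k.
    (* At distance [h] from [x], both [o] and the affine map have moved by less than
       half of the gap [z] between their values at [x]. *)
    pose h := Num.min (Num.min e r / 2) (Num.min (u / 2) (z / 2 / 2 ^ k)).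
    have h0 : 0 < h by rewrite !lt_min !divr_gt0.
    have : h <= h by [].
    rewrite {2}/h !le_min ler_pdivlMr// => /and3P[hm hu hz].
    have : F h = (-1) ^+ d * 2 ^ k * h + t by apply: FE; rewrite h0 /=; lra.
    rewrite /F => E; have := Hu (x + (-1) ^+ d * h).
    rewrite E opprD addNKr normrN normrM normr_sign mul1r gtr0_norm//.
    have hu' : h < u by move: hu hm; clear -u0; lra.
    move=> /(_ hu').
    have : z <= `|o x - ((-1) ^+ d * 2 ^ k * h + t)| + 2 ^ k * h.
      have -> : z = `|(o x - ((-1) ^+ d * 2 ^ k * h + t)) + (-1) ^+ d * 2 ^ k * h|.
        by congr (`| _ |); ring.
      apply: le_trans (ler_normD _ _) _; rewrite lerD2l !normrM normr_sign mul1r.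
      by rewrite !gtr0_norm.
    rewrite ler_pdivlMr// mulrC in hz.
    move: `|_ - (_ + t)| (2 ^ k * h) hz => y y' hz z1 z2; move: z1 z2 hz; clear; lra.
  move=> h /andP[h0 he].
  have [->|hn0] := eqVneq h 0; first by rewrite !mulr0 !addr0.
  have := FE h; rewrite /F => ->; first by rewrite tE; ring.
  by rewrite lt_neqAle eq_sym hn0 h0 /=; lra.
- exists 0; exists r => // h hr; rewrite rout// expr0z mul1r.
  by have := rout 0; rewrite mulr0 addr0 lexx (ltW r0) => ->.
Qed.
End Thompson.

(** * Non-embeddability *)

(** Only the maps supported in a segment matter. This is what allows an arbitrary
    interval, whose end points need not belong to [A]: the segment [p, q] is chosen
    inside, with [p] in [A] and [q - p] in [(a * b - 1) * A]. *)
Theorem not_embeds_thompsonF (R : realType) (A P : set R) (G : set (R -> R))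
    (a b lo hi : R) :
  positive_subgroup P -> nonzero_submodule P A -> P a -> P b -> 1 < a -> 1 < b ->
  multiplicatively_independent a b -> lo < hi ->
  (forall (o : oaut R) p q, lo <= p -> q <= hi -> pl A P o -> supp_in p q o -> G o) ->
  ~ embeds G (thompsonF R).
Proof.
move=> PG AM Pa Pb a1 b1 ab lohi GH [phi [phiF phi_inj phiM]].
have k0 : 0 < a * b - 1 by rewrite subr_gt0 mulr_egt1.
have [p Ap] := submodule_dense PG AM Pa a1 ltr01 lohi; rewrite mul1r => /andP[lop phi'].
have [|c Ac /andP[c0 chi]] := submodule_dense (y1 := 0) (y2 := hi - p) PG AM Pa a1 k0.
  by rewrite subr_gt0.
rewrite pmulr_rgt0// in c0.
pose H := pl_supp A P a b p c.
have HG : subgroup H by exact: pl_supp_group.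
have [H1 HM _] := HG.
have HinG o : H o -> G o.
  by move=> [plo so]; apply: GH plo so; [exact: ltW | rewrite -lerBrDl ltW].
have [Phi PhiE] : exists Phi : oaut R -> oaut R, forall f, H f ->
    [/\ (Phi f : R -> R) = phi f, forall x, ~~ (0 <= x <= 1) -> Phi f x = x &
    dyadic_germs (Phi f)].
  suff /choice[Phi PhiE] : forall f : oaut R, exists f' : oaut R, H f ->
      [/\ (f' : R -> R) = phi f, forall x, ~~ (0 <= x <= 1) -> f' x = x &
      dyadic_germs f'] by exists Phi.
  move=> f; have [Hf|nHf] := pselect (H f); last by exists f.
  by have [f' f'E] := thompsonF_oaut (phiF _ (HinG f Hf)); exists f'.
have PhiM f g : H f -> H g -> Phi (f * g)%g = (Phi f * Phi g)%g.
  move=> Hf Hg; have [Ef _ _] := PhiE f Hf; have [Eg _ _] := PhiE g Hg.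
  have [Efg _ _] := PhiE _ (HM _ _ Hf Hg).
  apply: oaut_ext => x; rewrite oautME Efg Ef Eg.
  by rewrite (phiM f g) //; exact: HinG.
apply: (pl_supp_no_dyadic_action PG AM Pa Pb a1 b1 ab Ap Ac c0 PhiM (lo := 0) (hi := 1)).
- by move=> f x /PhiE[_ + _]; exact.
- by move=> f /PhiE[].
- move=> f Hf Phif1.
  have [Ef _ _] := PhiE f Hf; have [E1 _ _] := PhiE _ H1.
  have Phi1 : Phi 1%g = 1%g by apply: (mulgI (Phi 1%g)); rewrite -PhiM// !mulg1.
  apply: oaut_ext => x.
  suff -> : (f : R -> R) = (1%g : oaut R) by [].
  apply: phi_inj; rewrite ?inE; [exact: HinG| exact: HinG|].
  by rewrite -Ef -E1 Phif1 Phi1.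
Qed.

(** * Rank and multiplicative independence *)

Section Rank.
Variables (R : realType) (P : set R).
Hypothesis PG : positive_subgroup P.
Variables (T : lmodType rat) (t : R -> rat -> T).
Hypothesis tP : is_tensor_rat P t.

Lemma tensor1 q : t 1 q = 0.
Proof.
have [[tM _] _ _ _] := tP; have P1 := subP1 PG.
by apply: (addrI (t 1 q)); rewrite -tM// mul1r addr0.
Qed.

Lemma tensorX x n q : P x -> P (x ^+ n) /\ t (x ^+ n) q = n%:R *: t x q.
Proof.
have [[tM _] _ _ _] := tP => Px; elim: n => [|n [PX IH]].
  by rewrite expr0 tensor1 scale0r; split => //; exact: subP1 PG.
rewrite exprS; split; first exact: (subPM PG).
by rewrite tM// IH mulrS scalerDl scale1r.
Qed.

Lemma tensor_dependent x y m n q : P x -> P y -> (0 < n)%N -> y ^+ n = x ^+ m ->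
  t y q = (m%:R / n%:R) *: t x q.
Proof.
move=> Px Py n0 E; have n0' : n%:R != 0 :> rat by rewrite pnatr_eq0 -lt0n.
apply: (scalerI n0'); rewrite scalerA mulrCA mulfV// mulr1.
by have [_ <-] := tensorX n q Py; have [_ <-] := tensorX m q Px; rewrite E.
Qed.

Lemma tensorV x q : P x -> t x^-1 q = - t x q.
Proof.
have [[tM _] _ _ _] := tP => Px; have PV := subPV PG Px.
apply/eqP; rewrite -addr_eq0 -tM// mulVf ?tensor1//.
by rewrite gt_eqF// (subP_gt0 PG).
Qed.

(** Additive maps on the tensor product are determined by their values on tensors, so
    [z = h z *: w] for every [z], and any two vectors are proportional to [w]. *)
Lemma tensor_line (h : {additive T -> rat}) (w : T) :
  (forall x q, P x -> t x q = h (t x q) *: w) -> ~ dim_gt T 1.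
Proof.
move=> th [v vfree]; have [_ _ _ tuniq] := tP.
have fadd : zmod_morphism (fun v => h v *: w).
  by move=> x y; rewrite raddfB scalerBl.
pose F : {additive T -> T} :=
  HB.pack (fun v => h v *: w) (GRing.isZmodMorphism.Build _ _ _ fadd).
have vE (z : T) : z = h z *: w by apply: (tuniq T idfun F).
(* The relation [h v1 *: v0 - h v0 *: v1 = 0]. *)
pose cc (i : 'I_2) : rat := if i == ord0 then h (v ord_max) else - h (v ord0).
have lE : lift ord0 ord0 = ord_max :> 'I_2 by exact/val_inj.
have cc0 : \sum_i cc i *: v i = 0.
  rewrite big_ord_recl big_ord1 /cc /= [v ord0 in X in X + _]vE.
  rewrite lE.
  by rewrite [v ord_max in X in _ + X]vE !scalerA mulNr mulrC scaleNr subrr.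
have h1 : h (v ord_max) = 0 by have := vfree _ cc0 ord0.
have h0 : h (v ord0) = 0 by have := vfree _ cc0 ord_max; rewrite /cc /= => /eqP; rewrite oppr_eq0 => /eqP.
have : (1 : rat) = 0.
  apply: (vfree (fun=> 1) _ ord0); rewrite big1// => i _; rewrite scale1r [LHS]vE.
  suff -> : h (v i) = 0 by rewrite scale0r.
  by case: (unliftP ord0 i) => [j ->|->//]; rewrite (ord1 j) lE.
by move/eqP; rewrite oner_eq0.
Qed.

(** The rational number [l y] with [ln y = l y * ln x] is additive in [y], so
    [(y, q) |-> l y * q] is bilinear and factors through a linear form. If
    [l y = m / n], then [y ^+ n = x ^+ m], and dividing by [n] in the tensor product
    gives [t y q = t x (l y * q)]: all tensors lie on the line of [t x 1]. *)
Lemma tensor_rank_le1 x : P x -> x != 1 ->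
  (forall y, P y -> exists l : rat, ln y = ratr l * ln x) -> ~ dim_gt T 1.
Proof.
move=> Px x1 dep.
have x0 := subP_gt0 PG Px.
have lnx : ln x != 0 by rewrite ln_eq0.
have /choice[l lE] : forall y, exists l : rat, P y -> ln y = ratr l * ln x.
  by move=> y; have [/dep[l ?]|] := pselect (P y); [exists l|exists 0].
have l_eq y r : P y -> ln y = ratr r * ln x -> l y = r.
  move=> Py; rewrite lE// => /(mulIf lnx); exact: fmorph_inj.
have [[tM tD] tZ text _] := tP.
have bil : bilinear_rat P (fun y q => l y * q : rat).
  split=> [y z q Py Pz|y q r _]; last exact: mulrDr.
  rewrite -mulrDl; congr (_ * _); apply: l_eq; first exact: (subPM PG).
  by rewrite lnM ?posrE ?(subP_gt0 PG)// (lE y Py) (lE z Pz) -mulrDl -rmorphD.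
have [h hE] := text _ _ bil.
apply: (@tensor_line h (t x 1)) => y q Py.
rewrite hE// tZ// mulr1.
have [m [n [n0 ynx]]] : exists m n, (0 < n)%N /\
    (y ^+ n = x ^+ m /\ l y = m%:R / n%:R \/ y ^+ n = x^-1 ^+ m /\ l y = - (m%:R / n%:R)).
  exists `|numq (l y)|%N, `|denq (l y)|%N; split; first by rewrite absz_gt0 denq_neq0.
  have dE : `|denq (l y)|%:R = (denq (l y))%:~R :> rat.
    by rewrite -[in RHS](gtz0_abs (denq_gt0 _)).
  have y0 := subP_gt0 PG Py.
  have lyx : (ln y) *+ `|denq (l y)| = (numq (l y))%:~R * ln x.
    have nd : l y * (denq (l y))%:~R = (numq (l y))%:~R.
      by rewrite -[X in X * _ = _]divq_num_den divfK// intr_eq0 denq_neq0.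
    rewrite lE// -mulr_natr mulrAC; congr (_ * _).
    by rewrite -[in LHS]ratr_nat dE -rmorphM /= nd ratr_int.
  have ln_inj' u v : 0 < u -> 0 < v -> ln u = ln v -> u = v :> R.
    by move=> u0 v0; apply: ln_inj; rewrite posrE.
  have [n0|n0] := leP 0 (numq (l y)); [left|right].
    have nE : `|numq (l y)|%:R = (numq (l y))%:~R :> R.
      by rewrite -[in RHS](gez0_abs n0).
    split; last first.
      by rewrite -[LHS]divq_num_den -dE -[in LHS](gez0_abs n0).
    by apply: ln_inj'; rewrite ?exprn_gt0// !lnXn// lyx -nE mulr_natl.
  have nE (S : pzRingType) : `|numq (l y)|%:R = - (numq (l y))%:~R :> S.
    by rewrite -rmorphN -(ltz0_abs n0).
  split; last by rewrite nE mulNr opprK -[LHS]divq_num_den -dE.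
  apply: ln_inj'; rewrite ?exprn_gt0 ?invr_gt0//.
  by rewrite !lnXn ?invr_gt0// lyx lnV ?posrE// mulNrn -mulr_natl nE mulNr opprK.
case: ynx => -[E ->].
  by rewrite (tensor_dependent _ Px Py n0 E) tZ.
by rewrite (tensor_dependent _ (subPV PG Px) Py n0 E) tensorV// scalerN -tZ// scaleNr.
Qed.
End Rank.

Lemma dependent_ln (R : realType) (a b : R) : 1 < a -> 1 < b ->
  ~ multiplicatively_independent a b -> exists l : rat, ln b = ratr l * ln a.
Proof.
move=> a1 b1 /existsNP[m /existsNP[n /not_implyP[E mn]]].
have [n0|n0] := eqVneq n 0%N.
  case: mn; split=> //; apply/eqP; apply: contraT => m0; move: E; rewrite n0 expr0.
  have : 1 < a ^+ m by rewrite exprn_egt1.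
  by move=> /[swap] ->; rewrite ltxx.
have a0 : 0 < a by lra.
have b0 : 0 < b by lra.
have n0' : n%:R != 0 :> R by rewrite pnatr_eq0.
exists (m%:R / n%:R); rewrite fmorph_div /= !ratr_nat.
apply: (mulfI n0'); rewrite mulrA mulrCA mulfV// mulr1.
by rewrite ![_%:R * _]mulr_natl -!lnXn// E.
Qed.

Lemma independent_pair (R : realType) (P : set R) :
  positive_subgroup P -> abelian_rank_gt P 1 ->
  exists a b, [/\ P a, P b, 1 < a, 1 < b & multiplicatively_independent a b].
Proof.
move=> PG [T [t [tP dimT]]]; apply: contrapT => nind.
have above x : P x -> x != 1 -> exists a (s : bool),
    [/\ P a, 1 < a & ln x = (-1) ^+ s * ln a].
  move=> Px x1; have x0 := subP_gt0 PG Px.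
  have [xlt|xgt|xE] := ltgtP x 1; last by rewrite xE eqxx in x1.
  - exists x^-1, true; split; [exact: (subPV PG) | by rewrite invf_gt1|].
    by rewrite lnV ?posrE// expr1 mulN1r opprK.
  - by exists x, false; split => //; rewrite expr0 mul1r.
have [[x Px x1]|triv] := pselect (exists2 x, P x & x != 1).
  apply: (tensor_rank_le1 PG tP Px x1) dimT => y Py.
  have [->|y1] := eqVneq y 1; first by exists 0; rewrite ln1 rmorph0 mul0r.
  have [a [s [Pa a1 lnx]]] := above x Px x1.
  have [b [s' [Pb b1 lny]]] := above y Py y1.
  have [l lE] : exists l : rat, ln b = ratr l * ln a.
    by apply: dependent_ln => // ab; apply: nind; exists a, b.
  exists ((-1) ^+ s' * l * (-1) ^+ s).
  by rewrite lny lE lnx !rmorphM !rmorph_sign /= -!mulrA signrMK.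
(* If [P] is trivial, so is the tensor product. *)
apply: (@tensor_line _ _ _ _ tP \0 0) dimT => x q Px.
have -> : x = 1 by apply: contrapT => /eqP x1; apply: triv; exists x.
by rewrite (tensor1 PG tP) scaler0.
Qed.

(** * Brown-Stein-Thompson groups *)

Section Stein.
Variables (R : realType) (n : nat) (p : 'I_n -> nat).
Hypothesis pP : forall i, prime (p i).
Let gens : set R := 2%:R |` [set (p i)%:R | i in [set: 'I_n]].
Let P : set R := smallest (@positive_subgroup R) gens.
Let N := (2 * \prod_(i < n) p i)%N.

Lemma gens_gt0 x : gens x -> 0 < x.
Proof. by move=> [->|[i _ <-]]; rewrite ltr0n// prime_gt0. Qed.

Lemma stein_N_gt0 : (0 < N)%N.
Proof. by rewrite muln_gt0 /=; apply: prodn_gt0 => i; exact: prime_gt0. Qed.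

Lemma stein_subgroup : positive_subgroup P.
Proof.
split.
- have posG : positive_subgroup [set x : R | 0 < x].
    split=> //= x; first exact: mulr_gt0.
    by rewrite invr_gt0.
  by move=> x /(_ _ (conj posG gens_gt0)).
- by move=> M [[_ M1 _ _] _].
- by move=> x y Px Py M MP; have [[_ _ MM _] _] := MP; apply: MM; [exact: Px|exact: Py].
- by move=> x Px M MP; have [[_ _ _ MV] _] := MP; apply: MV; exact: Px.
Qed.

(** Each generator of [P] divides [N], hence is invertible in Z[1/N]. The numbers that
    preserve Z[1/N] together with their inverses form a group, so all of [P] does. *)
Lemma stein_submodule : nonzero_submodule P (Zinv R N).
Proof.
have N0 : N%:R != 0 :> R by rewrite pnatr_eq0 -lt0n stein_N_gt0.
have NX k : N%:R ^+ k != 0 :> R by rewrite expf_neq0.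
split.
- by exists 0, 0%N; rewrite mul0r.
- move=> x y [a [k ->]] [b [l ->]].
  exists (a * (N ^ l)%N%:Z - b * (N ^ k)%N%:Z), (k + l)%N.
  rewrite rmorphB !rmorphM /= exprD -!natrX -!pmulrn.
  by field; rewrite !natrX ?NX.
- pose M := [set a : R | 0 < a /\ forall x, (Zinv R N x -> Zinv R N (a * x)) /\
      (Zinv R N x -> Zinv R N (a^-1 * x))].
  suff PM : P `<=` M by move=> a x /PM[_ /(_ x)[]].
  apply: smallest_sub.
    split.
    + by move=> x [].
    + by split => // x; rewrite invr1 mul1r.
    + move=> x y [x0 xM] [y0 yM]; split; first exact: mulr_gt0.
      move=> z; split=> Az; first by rewrite -mulrA; apply: (xM _).1; exact: (yM _).1.
      by rewrite invfM -mulrA; apply: (xM _).2; exact: (yM _).2.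
    + move=> x [x0 xM]; split; first by rewrite invr_gt0.
      by move=> z; rewrite invrK; split; [exact: (xM z).2|exact: (xM z).1].
  have dvd m : (0 < m)%N -> (m %| N)%N -> M m%:R.
    move=> m0 /dvdnP[r NE]; split; first by rewrite ltr0n.
    have m0' : m%:R != 0 :> R by rewrite pnatr_eq0 -lt0n.
    move=> x; split=> -[a [k ->]].
      by exists (m%:Z * a), k; rewrite rmorphM /= -pmulrn mulrA.
    exists (a * r%:Z), k.+1; rewrite rmorphM /= -pmulrn.
    have r0 : r%:R != 0 :> R.
      by move: N0; rewrite NE natrM mulf_eq0 negb_or => /andP[].
    rewrite exprS; move: (N%:R ^+ k) (NX k) => y y0; rewrite NE natrM; field.
    by rewrite y0 m0' r0.
  move=> x [->|[i _ <-]]; first by apply: dvd => //; exact: dvdn_mulr.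
  apply: dvd; first exact: prime_gt0.
  by apply: dvdn_mull; rewrite (bigD1 i)//= dvdn_mulr.
- by exists 1; [exists 1, 0%N; rewrite divr1 | exact: oner_neq0].
Qed.

(** A power of 2 that is odd equals 1. *)
Lemma stein_independent i : odd (p i) -> multiplicatively_independent (2 : R) (p i)%:R.
Proof.
move=> oddp k l /eqP; rewrite -!natrX eqr_nat => /eqP E.
have k0 : k = 0%N.
  by case: k E => // k E; have := congr1 odd E; rewrite !oddX oddp orbT.
split => //; apply: contrapT => /eqP l0.
by have := ltn_expl l (prime_gt1 (pP i)); rewrite -E k0 expn0; move: l0; case: (l).
Qed.
End Stein.

Theorem corollary1p7 (R : realType) :
  (forall (n : nat) (p : 'I_n -> nat),
      (1 <= n)%N ->
      injective p ->
      (forall i, prime (p i)) ->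
      (forall i, odd (p i)) ->
      ~ embeds (brown_stein_thompson R p) (thompsonF R)) /\
  (forall I A P : set R,
      (I = setT \/ exists a b : R, a < b /\ I = `[a, b]%classic) ->
      positive_subgroup P ->
      nonzero_submodule P A ->
      abelian_rank_gt P 1 ->
      ~ embeds (bieri_strebel I A P) (thompsonF R)).
Proof.
split.
- move=> n p n1 _ pP oddp; pose i := Ordinal n1.
  have PG := stein_subgroup R pP; have AM := stein_submodule R pP.
  set P := smallest _ _ in PG AM.
  have gP x : (2%:R |` [set (p i)%:R | i in [set: 'I_n]]) x -> P x.
    exact: sub_gen_smallest.
  apply: (not_embeds_thompsonF PG AM (a := 2%:R) (b := (p i)%:R) (lo := 0) (hi := 1)).
  + by apply: gP; left.
  + by apply: gP; right; exists i.
  + by rewrite ltr1n.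
  + by rewrite ltr1n prime_gt1.
  + exact: stein_independent.
  + exact: ltr01.
  + move=> o l r l0 r1 plo so.
    have lr01 : `[l, r] `<=` (`[0, 1] : set R).
      by move=> x /=; rewrite !in_itv /=; lra.
    split; [|exact: pl_breakpoints plo|exact: pl_slopes plo].
    apply: pl_homeo_supp plo so lr01 _ => x; rewrite itv01P => /negP.
    by rewrite negb_and -!ltNge => /orP[|] ?; [left|right]; lra.
- move=> I A P IE PG AM /(independent_pair PG)[a [b [Pa Pb a1 b1 ab]]].
  have [lo [hi [lohi I_lohi]]] : exists lo hi : R, lo < hi /\ `[lo, hi] `<=` I.
    case: IE => [->|[lo [hi [lohi ->]]]]; last by exists lo, hi; split => // x.
    by exists 0, 1; split => //; exact: ltr01.
  apply: (not_embeds_thompsonF PG AM Pa Pb a1 b1 ab lohi) => o l r l0 r1 plo so.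
  split; [|move=> x /eqP ox|exact: pl_slopes plo|exact: pl_breakpoints plo|exact: pl_image plo].
  + by apply: pl_homeo_supp plo so _ _ => // x nx; exfalso; exact: nx.
  + apply: I_lohi; rewrite /= in_itv /=; apply: contrapT => /negP.
    rewrite negb_and -!ltNge => out; apply: ox; apply: so.
    by case/orP: out => ?; [left|right]; lra.
Qed.
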